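(* Let $X\subseteq\{0,1\}^n$, $f:X\to\{0,1\}$, and let $\{\ket{v_{x,j}}\in\mathbb{C}^m\}_{x\in X,j\in[n]}$ be any family of vectors with size $A=\max_{x\in X}\sum_j\|\ket{v_{x,j}}\|^2\ge 1$. With $c=100$, define for $f(x)=1$ the unit vector $\ket{\psi_x}=\frac{1}{\sqrt{\nu_x}}\big(\ket{\hat0}+\frac{1}{\sqrt{cA}}\sum_{i\in[n]}\ket{i}\ket{v_{x,i}}\ket{x_i}\big)$, $\nu_x=1+\frac{1}{cA}\sum_i\|\ket{v_{x,i}}\|^2$, and for $f(x)=0$ the unit vector $\ket{\phi_x}=\frac{1}{\sqrt{\mu_x}}\big(\ket{\hat0}-\sqrt{cA}\sum_{i\in[n]}\ket{i}\ket{v_{x,i}}\ket{\bar x_i}\big)$, $\mu_x=1+cA\sum_i\|\ket{v_{x,i}}\|^2$, where $\bar x_i=1-x_i$. Let $\varepsilon=\max_{x,y:f(x)\ne f(y)}|\braket{\psi_x}{\phi_y}|$ (with $x\in f^{-1}(1)$, $y\in f^{-1}(0)$). Let $M$ be the matrix whose rows are $\bra{\psi_x}$ for $x\in f^{-1}(1)$, with nonzero singular values $s_1\ge s_2\ge\cdots\ge s_\kappa>0$ ($\kappa=\operatorname{rank}M$), set $s_{\kappa+1}=0$, and let $n_1=|f^{-1}(1)|$. If there exists $\kappa^*\in[\kappa]$ such that $$\varepsilon\le\frac{1}{\sqrt{n_1}}\left(\frac{s_{\kappa^*}}{2\sqrt{c}A}-s_{\kappa^*+1}\right)\quad\text{and}\quad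 s_{\kappa^*+1}\le\frac{1}{2\sqrt{1000c}\,A},$$ then there is a quantum query algorithm that evaluates $f(x)$ correctly with probability at least $2/3$ for every $x\in X$, using $O(A)$ queries and $O(\log(nm))$ qubits.
   Context: Vectors live in $\mathcal{H}=\mathbb{C}\oplus(\mathbb{C}^n\otimes\mathbb{C}^m\otimes\mathbb{C}^2)$, where $\ket{\hat0}$ is a unit vector spanning the first summand. A quantum query algorithm has the form $U_TO_xU_{T-1}O_x\cdots U_1O_xU_0\ket{\hat0}$ followed by a two-outcome measurement, with $x$-independent unitaries $U_t$ on a Hilbert space of dimension $S$ and oracle $O_x\ket{i}\ket{b}=\ket{i}\ket{b\oplus x_i}$; it uses $T$ queries and $\log S$ qubits. *)

(* Defs.v *)
From HB Require Import structures.
From mathcomp Require Import all_boot all_order all_algebra.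
From mathcomp Require Import reals.
From mathcomp Require Import complex.
Set Implicit Arguments. Unset Strict Implicit. Unset Printing Implicit Defensive.
Import Order.TTheory GRing.Theory Num.Theory.
Local Open Scope ring_scope.

Section Defs.
Variable R : realType.
Local Notation C := (R[i]).

Definition bits (n : nat) := {ffun 'I_n -> bool}.

Definition sqnorm m (u : 'rV[C]_m) : C := \sum_(k < m) `|u 0 k| ^+ 2.

(*  The vectors |psi_x>, |phi_x> of H = C (+) (C^n (x) C^m (x) C^2)     *)
(*  The basis of H is indexed by  option ('I_n * 'I_m * bool):         *)
(*  None is |hat0>, Some (i,k,b) is |i>|k>|b>.                          *)
Definition Hidx (n m : nat) := option ('I_n * 'I_m * bool).

Definition cconst : C := 100.

Definition sizeA n m (X : {set bits n}) (v : bits n -> 'I_n -> 'rV[C]_m) : C :=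
  \big[Num.max/0]_(x in X) \sum_(j < n) sqnorm (v x j).

Section Vecs.
Variables (n m : nat) (X : {set bits n}) (v : bits n -> 'I_n -> 'rV[C]_m).
Let A := sizeA X v.

Definition nu (x : bits n) : C := 1 + (cconst * A)^-1 * \sum_(i < n) sqnorm (v x i).
Definition mu (x : bits n) : C := 1 + cconst * A * \sum_(i < n) sqnorm (v x i).

Definition psi (x : bits n) (h : Hidx n m) : C :=
  match h with
  | None => (sqrtC (nu x))^-1
  | Some (i, k, b) =>
      (sqrtC (nu x))^-1 * (sqrtC (cconst * A))^-1 * v x i 0 k * (b == x i)%:R
  end.

Definition phi (x : bits n) (h : Hidx n m) : C :=
  match h with
  | None => (sqrtC (mu x))^-1
  | Some (i, k, b) =>
      - ((sqrtC (mu x))^-1 * sqrtC (cconst * A) * v x i 0 k * (b == ~~ x i)%:R)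
  end.

Definition braket (x y : bits n) : C :=
  \sum_(h : Hidx n m) (psi x h)^* * phi y h.

End Vecs.

Section Matrix.
Variables (n m : nat) (X : {set bits n}) (f : bits n -> bool)
          (v : bits n -> 'I_n -> 'rV[C]_m).

Definition X1 : {set bits n} := [set x in X | f x].
Definition X0 : {set bits n} := [set x in X | ~~ f x].

Definition epsilon : C :=
  \big[Num.max/0]_(x in X1) \big[Num.max/0]_(y in X0) `|braket X v x y|.

Definition Mmat : 'M[C]_(#|X1|, #|{: Hidx n m}|) :=
  \matrix_(r, h) (psi X v (enum_val r) (enum_val h))^*.
End Matrix.

(* sv is the full list of singular values of M : 'M_(p,q) (with
   multiplicity, p of them, zeros included), sorted non-increasingly:
   their squares are the eigenvalues (roots of the characteristic
   polynomial, with multiplicity) of M M^*. *)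
Definition singular_values p q (M : 'M[C]_(p, q)) (sv : seq C) : Prop :=
  [/\ size sv = p,
      sorted (fun a b => b <= a) sv,
      all (fun s => 0 <= s) sv
    & char_poly (M *m map_mx Num.conj (M ^T)) = \prod_(s <- sv) ('X - (s ^+ 2)%:P)].

(* 1-indexed s_j; s_j = 0 beyond the list (in particular s_{kappa+1} = 0) *)
Definition singval (sv : seq C) (j : nat) : C := nth 0 sv j.-1.

(*  Hilbert space with basis indexed by  'I_n * bool * 'I_w  (query     *)
(*  register |i>, answer bit |b>, workspace); S = #|qidx n w|, and the  *)
(*  number of qubits is log S.                                          *)
Definition qidx (n w : nat) := ('I_n * bool * 'I_w)%type.
Definition qdim n w := #|{: qidx n w}|.

Definition qflip n w (x : bits n) (t : qidx n w) : qidx n w :=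
  let: (i, b, k) := t in (i, b (+) x i, k).

Definition oracle n w (x : bits n) : 'M[C]_(qdim n w) :=
  \matrix_(a, b) (enum_val a == qflip x (enum_val b))%:R.

Definition basis_vec S (t0 : 'I_S) : 'cV[C]_S := \col_j (j == t0)%:R.

Fixpoint qstate n w (U : nat -> 'M[C]_(qdim n w)) (t0 : 'I_(qdim n w))
    (x : bits n) (t : nat) : 'cV[C]_(qdim n w) :=
  match t with
  | 0 => U 0%N *m basis_vec t0
  | t'.+1 => U t *m (oracle w x *m qstate U t0 x t')
  end.

Definition outprob n w (T : nat) (U : nat -> 'M[C]_(qdim n w))
    (t0 : 'I_(qdim n w)) (Acc : {set 'I_(qdim n w)}) (x : bits n) (b : bool) : C :=
  \sum_(a | (a \in Acc) == b) `|qstate U t0 x T a 0| ^+ 2.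
End Defs.

(* Main.v *)
(** Let Delta project onto the right singular vectors of M with singular value at
    least s_k, let Pi_x project onto |hat0> and the vectors |i>|k>|x_i>, and put
    U = (2 Pi_x - 1)(2 Delta - 1).  If f(x) = 1, then |psi_x> is fixed by Pi_x and
    s_{k+1}-close to its projection by Delta, so |hat0>, which is close to |psi_x>,
    is nearly fixed by U.  If f(x) = 0, then w = sqrt(mu_x) |phi_x> satisfies
    Pi_x w = |hat0>, hence |hat0> = (1 - U) w / 2 + (2 Pi_x - 1) Delta w with
    |w| = O(A) and |Delta w| at most about 1/2: up to the last term, |hat0> is a coboundary
    of U.

    Phase estimation would need log A ancilla qubits, and A is not bounded in terms
    of n and m.  The two cases are separated instead by a resonance experiment with
    a single ancilla qubit: U, controlled by the ancilla, alternates with a rotation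
    of the ancilla by a fixed angle of sine s = Theta(1/A), until the total angle is
    about pi/2.  A fixed vector of U drives the ancilla from |0> to |1>; on a
    coboundary (1 - U) w / 2 the drive is off resonance and the amplitude of |1>
    stays below |w| s / sqrt(1 - s^2). *)

Require Import Defs.
From HB Require Import structures.
From mathcomp Require Import all_boot all_order all_algebra.
From mathcomp Require Import reals complex spectral.
From mathcomp Require Import ring lra.
Import Order.TTheory GRing.Theory Num.Theory.
Local Open Scope ring_scope.

Set Implicit Arguments.
Unset Strict Implicit.
Unset Printing Implicit Defensive.
Local Open Scope sesquilinear_scope.

(** * Complex column vectors as a real Euclidean space *)

Section RealInnerProduct.
Variable R : rcfType.
Local Notation C := R[i].
Implicit Type n : nat.

(** The real part of the Hermitian product gives the same norm and is still preserved by unitaries,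
    and its values lie in the ordered field [R], where [lra] and [nra] apply. *)
Definition rip n (u v : 'cV[C]_n) : R := complex.Re ((u^t* *m v) 0 0).
Definition nrm n (u : 'cV[C]_n) : R := Num.sqrt (rip u u).

Lemma ReD (x y : C) : complex.Re (x + y) = complex.Re x + complex.Re y.
Proof. by case: x y => [? ?] []. Qed.

Lemma Re_sum (I : Type) (r : seq I) (P : pred I) (F : I -> C) :
  complex.Re (\sum_(i <- r | P i) F i) = \sum_(i <- r | P i) complex.Re (F i).
Proof. by apply: (big_morph (@complex.Re R)) => //; apply: ReD. Qed.

Lemma conj_conjc (x : C) : Num.conj x = conjc x.
Proof.
have [->|x0] := eqVneq x 0; first by rewrite rmorph0 conjc0.
by apply: (mulfI x0); rewrite -normCK sqr_normc.
Qed.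

Lemma ripE n (u v : 'cV[C]_n) : rip u v =
  \sum_i (complex.Re (u i 0) * complex.Re (v i 0)
          + complex.Im (u i 0) * complex.Im (v i 0)).
Proof.
rewrite /rip mxE Re_sum; apply: eq_bigr => i _.
rewrite !mxE conj_conjc; case: (u i 0) (v i 0) => [a b] [c d] /=.
by rewrite mulNr opprK.
Qed.

Lemma ripC n (u v : 'cV[C]_n) : rip u v = rip v u.
Proof. by rewrite !ripE; apply: eq_bigr => i _; rewrite mulrC [X in _ + X]mulrC. Qed.

Lemma ripDr n (u v w : 'cV[C]_n) : rip u (v + w) = rip u v + rip u w.
Proof. by rewrite /rip mulmxDr !mxE ReD. Qed.

Lemma ripZr n (a : R) (u v : 'cV[C]_n) : rip u (a%:C%C *: v) = a * rip u v.
Proof.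
rewrite /rip -scalemxAr mxE; case: (_ 0 0) => x y /=.
by rewrite mul0r subr0.
Qed.

Lemma ripNr n (u v : 'cV[C]_n) : rip u (- v) = - rip u v.
Proof. by rewrite -scaleN1r -(rmorphN1 (real_complex R)) ripZr mulN1r. Qed.

Lemma ripBr n (u v w : 'cV[C]_n) : rip u (v - w) = rip u v - rip u w.
Proof. by rewrite ripDr ripNr. Qed.

Lemma ripDl n (u v w : 'cV[C]_n) : rip (v + w) u = rip v u + rip w u.
Proof. by rewrite ripC ripDr !(ripC u). Qed.

Lemma ripZl n (a : R) (u v : 'cV[C]_n) : rip (a%:C%C *: v) u = a * rip v u.
Proof. by rewrite ripC ripZr ripC. Qed.

Lemma ripNl n (u v : 'cV[C]_n) : rip (- u) v = - rip u v.
Proof. by rewrite ripC ripNr ripC. Qed.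

Lemma ripBl n (u v w : 'cV[C]_n) : rip (v - w) u = rip v u - rip w u.
Proof. by rewrite ripC ripBr !(ripC u). Qed.

Lemma rip0r n (u : 'cV[C]_n) : rip u 0 = 0.
Proof. by rewrite /rip mulmx0 mxE. Qed.

Definition rip_lin := (ripDl, ripDr, ripNl, ripNr, ripZl, ripZr).

Lemma rip_ge0 n (u : 'cV[C]_n) : 0 <= rip u u.
Proof. by rewrite ripE sumr_ge0 // => i _; rewrite addr_ge0 // -expr2 sqr_ge0. Qed.

Lemma rip_sqnorm n (u : 'cV[C]_n) :
  (rip u u)%:C%C = \sum_i `|u i 0| ^+ 2.
Proof.
rewrite ripE rmorph_sum /=; apply: eq_bigr => i _.
by rewrite -add_Re2_Im2 !expr2.
Qed.

Lemma rip_eq0 n (u : 'cV[C]_n) : rip u u = 0 -> u = 0.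
Proof.
move=> u0; apply/colP => i; rewrite mxE; apply/eqP.
rewrite -normr_eq0 -sqrf_eq0; apply/eqP.
have : \sum_i `|u i 0| ^+ 2 = 0 :> C by rewrite -rip_sqnorm u0.
by move=> /psumr_eq0P -> // j _; rewrite exprn_ge0.
Qed.

(** For N > 0 the form at (N, -t) is N (U N - t^2). For N = 0 and a = 1 it is affine in b with slope
    2 t, so t <> 0 would let it reach -1. *)
Lemma quad_form_discr (U t N : R) : 0 <= U -> 0 <= N ->
  (forall a b : R, 0 <= a ^+ 2 * U + 2 * (a * b * t) + b ^+ 2 * N) ->
  t ^+ 2 <= U * N.
Proof.
move=> U0 N0 quad; have [NZ|NZ] := eqVneq N 0; last first.
  have Np : 0 < N by rewrite lt_def NZ.
  have := quad N (- t).
  have -> : N ^+ 2 * U + 2 * (N * - t * t) + (- t) ^+ 2 * N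
            = N * (U * N - t ^+ 2) by ring.
  by rewrite pmulr_rge0 // subr_ge0.
have [->|t0] := eqVneq t 0; first by rewrite expr0n mulr_ge0.
have := quad 1 (- (U + 1) / (2 * t)); rewrite NZ mulr0 addr0.
have -> : 1 ^+ 2 * U + 2 * (1 * (- (U + 1) / (2 * t)) * t) = -1 by field.
by rewrite oppr_ge0 ler10.
Qed.

Lemma rip_sqr_le n (u v : 'cV[C]_n) : rip u v ^+ 2 <= rip u u * rip v v.
Proof.
apply: quad_form_discr (rip_ge0 u) (rip_ge0 v) _ => a b.
have := rip_ge0 (a%:C%C *: u + b%:C%C *: v); rewrite !rip_lin (ripC v u).
congr (_ <= _); move: (rip u u) (rip u v) (rip v v) => U t N; ring.
Qed.

Lemma nrm_ge0 n (u : 'cV[C]_n) : 0 <= nrm u.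
Proof. exact: sqrtr_ge0. Qed.

Lemma nrm_sqr n (u : 'cV[C]_n) : nrm u ^+ 2 = rip u u.
Proof. by rewrite sqr_sqrtr // rip_ge0. Qed.

Lemma rip_le n (u v : 'cV[C]_n) : rip u v <= nrm u * nrm v.
Proof.
apply: le_trans (ler_norm _) _; rewrite -ler_sqr ?nnegrE ?mulr_ge0 ?nrm_ge0 //.
by rewrite exprMn !nrm_sqr real_normK ?num_real ?rip_sqr_le.
Qed.

Lemma nrm_leP n (u : 'cV[C]_n) (a : R) : 0 <= a -> (nrm u <= a) = (rip u u <= a ^+ 2).
Proof. by move=> a0; rewrite -nrm_sqr ler_sqr // nnegrE ?nrm_ge0. Qed.

Lemma nrmD n (u v : 'cV[C]_n) : nrm (u + v) <= nrm u + nrm v.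
Proof.
rewrite nrm_leP ?addr_ge0 ?nrm_ge0 // !rip_lin (ripC v u) -!nrm_sqr.
have := rip_le u v; nra.
Qed.

Lemma nrmZ n (a : R) (u : 'cV[C]_n) : 0 <= a -> nrm (a%:C%C *: u) = a * nrm u.
Proof.
move=> a0; rewrite /nrm !rip_lin mulrA sqrtrM ?mulr_ge0 //.
by rewrite -expr2 sqrtr_sqr ger0_norm.
Qed.

Lemma nrmN n (u : 'cV[C]_n) : nrm (- u) = nrm u.
Proof. by rewrite /nrm !rip_lin opprK. Qed.

Lemma nrm0 n : nrm (0 : 'cV[C]_n) = 0.
Proof. by rewrite /nrm rip0r sqrtr0. Qed.

Lemma adjM m n p (A : 'M[C]_(m, n)) (B : 'M[C]_(n, p)) :
  (A *m B)^t* = B^t* *m A^t*.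
Proof. by rewrite trmx_mul map_mxM. Qed.

Lemma rip_adj m n (U : 'M[C]_(m, n)) u v : rip (U *m u) v = rip u (U^t* *m v).
Proof. by rewrite /rip adjM mulmxA. Qed.

Lemma rip_unitary n (U : 'M[C]_n) u v :
  U \is unitarymx -> rip (U *m u) (U *m v) = rip u v.
Proof.
move=> UU; rewrite rip_adj mulmxA.
by have /unitarymxP/mulmx1C -> := UU; rewrite mul1mx.
Qed.

Lemma nrm_unitary n (U : 'M[C]_n) u : U \is unitarymx -> nrm (U *m u) = nrm u.
Proof. by move=> UU; rewrite /nrm rip_unitary. Qed.

Lemma rip_col_mx m n (a c : 'cV[C]_m) (b d : 'cV[C]_n) :
  rip (col_mx a b) (col_mx c d) = rip a c + rip b d.
Proof. by rewrite /rip tr_col_mx map_row_mx mul_row_col mxE ReD. Qed.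

Lemma nrm_usubmx m n (u : 'cV[C]_(m + n)) : nrm (usubmx u) <= nrm u.
Proof.
rewrite nrm_leP ?nrm_ge0 // nrm_sqr -[X in _ <= rip X X]vsubmxK rip_col_mx.
by rewrite lerDl rip_ge0.
Qed.

Lemma nrm_dsubmx m n (u : 'cV[C]_(m + n)) : nrm (dsubmx u) <= nrm u.
Proof.
rewrite nrm_leP ?nrm_ge0 // nrm_sqr -[X in _ <= rip X X]vsubmxK rip_col_mx.
by rewrite lerDr rip_ge0.
Qed.

End RealInnerProduct.

(** * A controlled unitary alternating with rotations of the ancilla *)

Section RabiPulse.
Variable R : rcfType.
Local Notation C := R[i].

Section Iterates.
Variables (n : nat) (V : 'M[C]_n).

Lemma iter_mulmxD t (a b : 'cV[C]_n) :
  iter t (mulmx V) (a + b) = iter t (mulmx V) a + iter t (mulmx V) b.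
Proof. by elim: t => //= t ->; rewrite mulmxDr. Qed.

Lemma iter_mulmxZ t (x : C) (a : 'cV[C]_n) :
  iter t (mulmx V) (x *: a) = x *: iter t (mulmx V) a.
Proof. by elim: t => //= t ->; rewrite -scalemxAr. Qed.

Lemma iter_mulmx_comm (W : 'M[C]_n) t (a : 'cV[C]_n) :
  (forall x : 'cV[C]_n, W *m (V *m x) = V *m (W *m x)) ->
  iter t (mulmx V) (W *m a) = W *m iter t (mulmx V) a.
Proof. by move=> WV; elim: t => //= t ->; rewrite WV. Qed.

Hypothesis VU : V \is unitarymx.

Lemma nrm_iter t (a : 'cV[C]_n) : nrm (iter t (mulmx V) a) = nrm a.
Proof. by elim: t => //= t <-; rewrite nrm_unitary. Qed.

Lemma rip_iter t (a : 'cV[C]_n) :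
  rip (iter t (mulmx V) a) (V *m iter t (mulmx V) a) = rip a (V *m a).
Proof. by elim: t => [|t <-]; rewrite // !iterS rip_unitary. Qed.

End Iterates.

(** For c = cos theta and s = sin theta this is (cos (t theta), sin (t theta)), built from the
    addition formulas alone. *)
Fixpoint cossin (c s : R) (t : nat) : R * R :=
  if t is t'.+1 then
    let: (x, y) := cossin c s t' in (c * x - s * y, s * x + c * y)
  else (1, 0).

(** The ancilla is the block index: the upper block is its branch |0>, the lower block its branch
    |1>. *)
Definition rotmx d (c s : R) : 'M[C]_(d + d) :=
  block_mx (c%:C%C)%:M ((- s)%:C%C)%:M (s%:C%C)%:M (c%:C%C)%:M.

Definition ctrl d (U : 'M[C]_d) : 'M[C]_(d + d) := block_mx 1%:M 0 0 U.

Lemma rotmx_unitary d (c s : R) : c ^+ 2 + s ^+ 2 = 1 -> rotmx d c s \is unitarymx.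
Proof.
move=> cs; apply/unitarymxP.
have conjR (x : R) : (x%:C%C%:M : 'M[C]_d)^t* = x%:C%C%:M.
  by rewrite tr_scalar_mx map_scalar_mx /= conj_conjc conjc_real.
rewrite /rotmx tr_block_mx map_block_mx !conjR mulmx_block -!scalar_mxM.
rewrite -!rmorphM -!rmorphD /= !mulNr !mulrN opprK -!expr2 cs [s ^+ 2 + _]addrC cs.
by rewrite (mulrC c s) subrr !rmorph0 -scalar_mx_block.
Qed.

Lemma ctrl_unitary d (U : 'M[C]_d) : U \is unitarymx -> ctrl U \is unitarymx.
Proof.
move=> /unitarymxP UU; apply/unitarymxP.
rewrite /ctrl tr_block_mx map_block_mx mulmx_block trmx1 map_mx1 !trmx0 !map_mx0.
by rewrite UU !mulmx0 !mul0mx !mulmx1 !addr0 !add0r -scalar_mx_block.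
Qed.

Lemma ctrlM d (U W : 'M[C]_d) : ctrl (U *m W) = ctrl U *m ctrl W.
Proof.
by rewrite /ctrl mulmx_block !mulmx0 !mul0mx !mulmx1 !addr0 !add0r.
Qed.

Section Pulse.
Variables (d : nat) (c s : R) (U : 'M[C]_d).
Hypotheses (cs : c ^+ 2 + s ^+ 2 = 1) (UU : U \is unitarymx).

Definition rabi := rotmx d c s *m ctrl U.

Lemma rabi_unitary : rabi \is unitarymx.
Proof. by rewrite mul_unitarymx ?rotmx_unitary ?ctrl_unitary. Qed.

Lemma rabi_col (p q : 'cV[C]_d) : rabi *m col_mx p q =
  col_mx (c%:C%C *: p - s%:C%C *: (U *m q)) (s%:C%C *: p + c%:C%C *: (U *m q)).
Proof.
rewrite -mulmxA !mul_block_col !mul1mx !mul0mx addr0 add0r.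
by rewrite !mul_scalar_mx rmorphN scaleNr.
Qed.

(** This is U acting whatever the ancilla. The rotation has scalar blocks, so it commutes with
    [rabi] and lets 1 - U pass through the evolution. *)
Definition dbl : 'M[C]_(d + d) := block_mx U 0 0 U.

Lemma dbl_col (p q : 'cV[C]_d) : dbl *m col_mx p q = col_mx (U *m p) (U *m q).
Proof. by rewrite mul_block_col !mul0mx addr0 add0r. Qed.

Lemma dbl_rabi (x : 'cV[C]_(d + d)) : dbl *m (rabi *m x) = rabi *m (dbl *m x).
Proof.
rewrite -[x]vsubmxK dbl_col !rabi_col dbl_col.
by rewrite mulmxBr mulmxDr -!scalemxAr.
Qed.

(* Besides the norm, [rabi] preserves the form [rip x (rabi x)]; comparing the
   two at times 0 and t confines the lower block near the fixed space of U. *)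
Lemma rabi_offres t (h : 'cV[C]_d)
    (q := dsubmx (iter t (mulmx rabi) (col_mx h 0))) : 0 <= s ->
  c * nrm (q - U *m q) <= 2 * s * nrm h.
Proof.
rewrite {}/q; set x := iter _ _ _.
pose p := usubmx x; set q := dsubmx x => s0.
have Ex : x = col_mx p q by rewrite vsubmxK.
have nx : nrm x = nrm h.
  rewrite nrm_iter ?rabi_unitary //.
  by rewrite /nrm rip_col_mx rip0r addr0.
have := rip_iter rabi_unitary t (col_mx h 0); rewrite -/x Ex.
rewrite !rabi_col mulmx0 !scaler0 subr0 addr0 !rip_col_mx (ripC 0) rip0r addr0.
have := congr1 (fun y => y ^+ 2) nx; rewrite !nrm_sqr Ex rip_col_mx.
have : nrm p <= nrm h by rewrite -nx nrm_usubmx.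
have := rip_le p (q - U *m q).
have := rip_unitary q q UU.
have := nrm_sqr (q - U *m q).
have := nrm_ge0 p; have := nrm_ge0 (q - U *m q).
move: (nrm (q - U *m q)) => D; rewrite !rip_lin => D0.
rewrite (ripC (U *m q) q) (ripC q p).
move: (nrm p) (nrm h) (rip h h) (rip p p) (rip q q) (rip q (U *m q)) (rip p q)
  (rip p (U *m q)) (rip (U *m q) (U *m q)) => np nh hh pp qq qUq pq pUq UqUq.
move=> np0 DE UqE pD ple nE E.
have [->|Dn0] := eqVneq D 0.
  by rewrite mulr0 !mulr_ge0 // (le_trans np0 ple).
have Dp : 0 < D by rewrite lt_def Dn0.
(* The conserved form yields c (<q,q> - <q,Uq>) = s <p, q - Uq>, and D^2 = 2 (<q,q> - <q,Uq>) since
   U preserves the norm of q. Cauchy-Schwarz on the right then cancels one factor D. *)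
have DsE : c * D ^+ 2 = 2 * s * (pq - pUq).
  rewrite DE UqE; move: E; rewrite -nE mulrDr => E; lra.
rewrite -(ler_pM2r Dp).
have -> : c * D * D = 2 * s * (pq - pUq) by rewrite -DsE; ring.
rewrite -[leRHS]mulrA ler_wpM2l ?mulr_ge0 //.
by apply: le_trans pD _; rewrite ler_wpM2r.
Qed.

(* With D u := u - U u, the bound of [rabi_offres] at h = w/2 applies to D w / 2,
   because D commutes with the evolution. *)
Lemma rabi_reject t (w e : 'cV[C]_d) : 0 < c -> 0 <= s ->
  nrm (dsubmx (iter t (mulmx rabi) (col_mx (2^-1%:C%C *: (w - U *m w) + e) 0)))
  <= s / c * nrm w + nrm e.
Proof.
move=> c0 s0.
have -> : col_mx (2^-1%:C%C *: (w - U *m w) + e) 0 =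
  (2^-1%:C%C *: col_mx w 0 + (- 2^-1%:C%C) *: (dbl *m col_mx w 0)) + col_mx e 0.
  rewrite dbl_col mulmx0 !scale_col_mx !add_col_mx !scaler0 !addr0.
  by rewrite scaleNr -scalerBr.
rewrite !iter_mulmxD !iter_mulmxZ (iter_mulmx_comm _ _ dbl_rabi).
set x := iter t _ (col_mx w 0); set y := iter t _ (col_mx e 0).
rewrite -[x]vsubmxK -[y]vsubmxK dbl_col !scale_col_mx !add_col_mx col_mxKd.
apply: le_trans (nrmD _ _) _; apply: lerD; last first.
  apply: le_trans (nrm_dsubmx _) _; rewrite nrm_iter ?rabi_unitary //.
  by rewrite /nrm rip_col_mx rip0r addr0.
rewrite scaleNr -scalerBr nrmZ ?invr_ge0 //.
have := rabi_offres t w s0; rewrite -/x => H.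
rewrite mulrC ler_pdivrMr // -(ler_pM2l c0).
suff -> : c * (s / c * nrm w * 2) = 2 * s * nrm w by [].
by field; rewrite gt_eqF.
Qed.

(** If U fixed g, the evolution would be a pure rotation of the ancilla. Only the lower branch, of
    amplitude sin (r theta), meets U, so step r adds an error of at most eta sin (r theta), and
    later steps preserve its norm. *)
Lemma rabi_resonant t (g : 'cV[C]_d) (eta : R) : nrm (U *m g - g) <= eta ->
  (forall r, (r < t)%N -> 0 <= (cossin c s r).2) ->
  nrm (iter t (mulmx rabi) (col_mx g 0)
       - col_mx ((cossin c s t).1%:C%C *: g) ((cossin c s t).2%:C%C *: g))
  <= eta * \sum_(r < t) (cossin c s r).2.
Proof.
move=> Ug; elim: t => [|t IH] s0 /=.
  by rewrite big_ord0 mulr0 scale1r scale0r subrr nrm0.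
rewrite big_ord_recr mulrDr.
have {}IH := IH (fun r rt => s0 r (ltnW rt)).
have := s0 t (ltnSn t); case: (cossin c s t) IH => x y /= IH y0.
set X := iter t _ _ in IH *.
have -> : rabi *m X
    - col_mx ((c * x - s * y)%:C%C *: g) ((s * x + c * y)%:C%C *: g) =
  rabi *m (X - col_mx (x%:C%C *: g) (y%:C%C *: g))
  + rotmx d c s *m col_mx 0 (y%:C%C *: (U *m g - g)).
  rewrite mulmxBr rabi_col mul_block_col !mulmx0 !add0r !mul_scalar_mx.
  rewrite -addrA; congr (_ + _); rewrite !opp_col_mx add_col_mx.
  rewrite !rmorphB !rmorphD !rmorphM rmorphN /= -!scalemxAr.
  by congr col_mx; apply/colP=> i; rewrite !mxE; ring.
apply: le_trans (nrmD _ _) _.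
rewrite !nrm_unitary ?rabi_unitary ?rotmx_unitary //; apply: lerD => //.
rewrite {1}/nrm rip_col_mx rip0r add0r -/(nrm _) nrmZ // mulrC ler_wpM2r //.
Qed.

End Pulse.

(** * Discrete rotations: sums of sines and cosines, and the time of a quarter turn *)

Section Rotation.
Variables (c s : R).
Hypothesis cs : c ^+ 2 + s ^+ 2 = 1.

Lemma rot_sqr t : (cossin c s t).1 ^+ 2 + (cossin c s t).2 ^+ 2 = 1.
Proof.
elim: t => [|t] /=; first by rewrite expr0n addr0 expr1n.
case: (cossin c s t) => x y /= E.
by rewrite -[RHS](mulr1 1) -{1}cs -E; ring.
Qed.

(** Telescoping: 2 sin theta sin (r theta) = cos ((r-1) theta) - cos ((r+1) theta). *)
Lemma sum_sin t : 2 * s * \sum_(r < t.+1) (cossin c s r).2 =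
  1 + c - (cossin c s t.+1).1 - (cossin c s t).1.
Proof.
elim: t => [|t IH]; first by rewrite big_ord1 /=; ring.
rewrite big_ord_recr mulrDr IH /=.
case: (cossin c s t) => x y /=.
have : x = (c ^+ 2 + s ^+ 2) * x by rewrite cs mul1r.
lra.
Qed.

Lemma sum_cos t : 2 * s * \sum_(r < t.+1) (cossin c s r).1 =
  s + (cossin c s t.+1).2 + (cossin c s t).2.
Proof.
elim: t => [|t IH]; first by rewrite big_ord1 /=; ring.
rewrite big_ord_recr mulrDr IH /=.
case: (cossin c s t) => x y /=.
have : y = (c ^+ 2 + s ^+ 2) * y by rewrite cs mul1r.
lra.
Qed.

Hypotheses (c0 : 0 < c) (s0 : 0 < s).

Lemma rot_sin_ge0 t : (forall r, (r < t)%N -> 0 <= (cossin c s r).1) ->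
  0 <= (cossin c s t).2.
Proof.
elim: t => [|t IH] //= x0.
have := IH (fun r rt => x0 r (ltnW rt)); have := x0 t (ltnSn t).
case: (cossin c s t) => x y /= xp yp.
by rewrite addr_ge0 // mulr_ge0 // ltW.
Qed.

(** In the first quadrant cos + sin >= 1, so the number of steps is at most the sum of both. By the
    closed forms, 2 s times that sum is at most 6. *)
Lemma rot_time_le t : (forall r, (r <= t)%N -> 0 <= (cossin c s r).1) ->
  t.+1%:R <= 3 / s.
Proof.
move=> x0.
have y0 r : (r <= t.+1)%N -> 0 <= (cossin c s r).2.
  by move=> rt; apply: rot_sin_ge0 => r' r'r; apply: x0; rewrite -ltnS (leq_trans r'r).
have le1 (x y : R) : x ^+ 2 + y ^+ 2 = 1 -> - 1 <= x /\ y <= 1 by nra.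
have : t.+1%:R <= \sum_(r < t.+1) ((cossin c s r).1 + (cossin c s r).2).
  rewrite -[t.+1 in leLHS]card_ord -sumr_const; apply: ler_sum => i _.
  have := x0 i (ltn_ord i : (i <= t)%N); have := y0 i (ltnW (ltn_ord i)).
  have := rot_sqr i; nra.
rewrite big_split /= => /le_trans -> //.
rewrite ler_pdivlMr //; have := sum_sin t; have := sum_cos t.
have [_ ?] := le1 _ _ (rot_sqr t); have [? ?] := le1 _ _ (rot_sqr t.+1).
have [_ ?] := le1 _ _ cs; have [_ ?] := le1 s c (etrans (addrC _ _) cs).
have := x0 t (leqnn t).
by move: (\sum_(i < _) _) (\sum_(i < _) _) => S S'; lra.
Qed.

End Rotation.
End RabiPulse.

(** T is the last time before the cosine first turns negative. With (x, y) the pair at time T, the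
    next cosine c x - s y is negative and y <= 1, hence x <= s / c. *)
Lemma rot_quarter_turn (R : realType) (c s : R) :
    c ^+ 2 + s ^+ 2 = 1 -> 0 < c -> 0 < s ->
  exists T, [/\ T%:R <= 3 / s, forall r, (r < T)%N -> 0 <= (cossin c s r).2,
    (cossin c s T).1 <= s / c, 0 <= (cossin c s T).1
    & s * \sum_(r < T) (cossin c s r).2 <= 1].
Proof.
move=> cs c0 s0.
have ex : exists t, (cossin c s t.+1).1 < 0.
  have [n nP] : exists n, 3 / s < n.+1%:R.
    exists (Num.bound (3 / s)); rewrite (lt_trans (archi_boundP _)) ?ltr_nat //.
    by rewrite divr_ge0 // ltW.
  (* If the cosines were nonnegative up to time n, [rot_time_le] would give n + 1 <= 3 / s, against
     the choice of n. *)
  have [/forallP/= xp|] := boolP [forall t : 'I_n.+1, 0 <= (cossin c s t).1].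
    have := @rot_time_le _ c s cs c0 s0 n (fun r rn => xp (Ordinal (rn : (r < n.+1)%N))).
    by rewrite leNgt nP.
  case/forallPn => -[[|t] tn] /=; first by rewrite ler01.
  by rewrite -ltNge; exists t.
case: (ex_minnP ex) => T xT minT; exists T.
have xp r : (r <= T)%N -> 0 <= (cossin c s r).1.
  case: r => [|r] rT; first exact: ler01.
  by rewrite leNgt; apply/negP => /minT; rewrite leqNgt rT.
have yp r : (r <= T)%N -> 0 <= (cossin c s r).2.
  by move=> rT; apply: rot_sin_ge0 => // r' r'r; rewrite xp // ltnW // (leq_trans r'r).
split; last 2 first.
- exact: xp.
(* By [sum_sin], twice the left side is 1 + c minus two nonnegative cosines, so at most 2. *)
- case: T xT {minT} xp yp => [|t] xT xp yp; first by rewrite big_ord0 mulr0.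
  have := sum_sin cs t; have := xp t (leqnSn t); have := xp t.+1 (leqnn _).
  have c1 : c <= 1 by nra.
  by move: (\sum_(r < _) _) => S; lra.
- by rewrite (le_trans _ (rot_time_le cs c0 s0 xp)) // ler_nat.
- by move=> r /ltnW; apply: yp.
- have := rot_sqr cs T; have := yp T (leqnn T); move: xT => /=.
  case: (cossin c s T) => x y /= xT y0 xy; rewrite ler_pdivlMr // mulrC.
  have y1 : y <= 1 by nra.
  nra.
Qed.

(** * Spectral projector onto the large singular values *)

Section TruncatedProjector.
Variable R : realType.
Local Notation C := R[i].

Definition rdiag n (e : 'I_n -> R) : 'M[C]_n := diag_mx (\row_j (e j)%:C%C).

Lemma rdiagM n (e f : 'I_n -> R) : rdiag e *m rdiag f = rdiag (fun j => e j * f j).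
Proof.
rewrite /rdiag mulmx_diag; congr diag_mx.
by apply/rowP => j; rewrite !mxE rmorphM.
Qed.

Lemma rdiagB n (e f : 'I_n -> R) : rdiag e - rdiag f = rdiag (fun j => e j - f j).
Proof. by apply/matrixP => i j; rewrite !mxE -mulrnBl rmorphB. Qed.

Lemma rdiag_adj n (e : 'I_n -> R) : (rdiag e)^t* = rdiag e.
Proof.
rewrite /rdiag tr_diag_mx map_diag_mx; congr diag_mx.
by apply/rowP => j; rewrite !mxE /= conj_conjc conjc_real.
Qed.

Lemma rip_rdiag n (e : 'I_n -> R) (z : 'cV[C]_n) : rip z (rdiag e *m z) =
  \sum_j e j * (complex.Re (z j 0) ^+ 2 + complex.Im (z j 0) ^+ 2).
Proof.
rewrite ripE; apply: eq_bigr => j _; rewrite mul_diag_mx !mxE.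
case: (z j 0) => x y /=; rewrite !mul0r subr0 addr0; ring.
Qed.

Lemma rip_rdiag_le n (e : 'I_n -> R) (a : R) (z : 'cV[C]_n) :
  (forall j, e j <= a) -> rip z (rdiag e *m z) <= a * rip z z.
Proof.
move=> ea; rewrite rip_rdiag ripE mulr_sumr; apply: ler_sum => j _.
by rewrite -!expr2 ler_wpM2r // addr_ge0 ?sqr_ge0.
Qed.

(** The rows of the spectral matrix are left eigenvectors, nonzero because that matrix is
    invertible; so the diagonal entries are roots of the characteristic polynomial. *)
Lemma hermitian_eigen n (G : 'M[C]_n) : G^t* = G ->
  exists P (D : 'rV[C]_n), [/\ P \is unitarymx, G = P^t* *m diag_mx D *m P
    & forall j, root (char_poly G) (D 0 j)].
Proof.
move=> GH; have /orthomx_spectralP GE : G \is normalmx.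
  by apply/normalmxP; rewrite GH.
have PU := spectral_unitarymx G.
exists (spectralmx G), (spectral_diag G); split=> //.
  by rewrite -invmx_unitary.
move=> j; rewrite -eigenvalue_root_char; apply/eigenvalueP.
exists (row j (spectralmx G)).
  rewrite {2}GE -row_mul !mulmxA mulmxV ?spectral_unit // mul1mx.
  by rewrite row_mul row_diag_mx -scalemxAl -rowE.
apply: contraTneq (spectral_unit G) => r0.
rewrite -row_free_unit; apply/negP => /row_freeP [B].
move/(congr1 (fun X => row j X 0 j)); rewrite row_mul r0 mul0mx !mxE eqxx.
by move/eqP; rewrite eq_sym oner_eq0.
Qed.

(* D projects onto the right singular vectors whose squared singular value is at
   least s_k^2 (and nonzero): it is M^* G' M, where G' inverts M M^* on these. *)
Lemma truncated_projector p d (M : 'M[C]_(p, d)) (sv : seq C) (k : nat) :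
    singular_values M sv -> (0 < k)%N ->
  exists D : 'M[C]_d, [/\ D^t* = D, D *m D = D,
    forall x : 'cV[C]_d,
      complex.Re (singval sv k) ^+ 2 * rip (D *m x) (D *m x) <= rip (M *m x) (M *m x),
    forall x : 'cV[C]_d, M *m x = 0 -> D *m x = 0
    & forall (u : 'cV[C]_p) (g : 'cV[C]_d), g = M^t* *m u ->
      rip (g - D *m g) (g - D *m g) <= complex.Re (singval sv k.+1) ^+ 2 * rip u u].
Proof.
move=> [szv srt pos chE] k0; set sk := complex.Re (singval sv k).
set sk1 := complex.Re (singval sv k.+1).
set G := M *m M^t*.
have GH : G^t* = G by rewrite adjM trmxCK.
have [P [D [PU GE Droot]]] := hermitian_eigen GH.
have svE j : D 0 j \in [seq s ^+ 2 | s <- sv].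
  have := Droot j.
  have -> : char_poly G = \prod_(z <- [seq s ^+ 2 | s <- sv]) ('X - z%:P).
    by rewrite big_map -chE.
  by rewrite root_prod_XsubC.
have nthge0 i : 0 <= nth 0 sv i.
  have [iv|iv] := ltnP i (size sv); last by rewrite nth_default.
  by move/allP: pos; apply; rewrite mem_nth.
have nthR i : nth 0 sv i = (complex.Re (nth 0 sv i))%:C%C.
  by rewrite RRe_real // ger0_real.
have reP i : 0 <= complex.Re (nth 0 sv i) by have := nthge0 i; rewrite {1}nthR ler0c.
have DlamE j : exists2 l : R, D 0 j = l%:C%C &
    exists i, l = complex.Re (nth 0 sv i) ^+ 2.
  have /mapP[s /(nthP 0) [i iv <-] ->] := svE j.
  by exists (complex.Re (nth 0 sv i) ^+ 2); [rewrite {1}nthR rmorphXn | exists i].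
have /fin_all_exists2[lam DE lamE] := DlamE.
have {}DE : diag_mx D = rdiag lam.
  by congr diag_mx; apply/rowP => j; rewrite !mxE DE.
rewrite {}DE in GE.
have lam0 j : 0 <= lam j by case: (lamE j) => i ->; rewrite sqr_ge0.
(* A discarded nonzero eigenvalue is below s_k^2, so by sortedness its 0-based index is at least k,
   and entry k of [sv] is s_(k+1). *)
have lamK j : ~~ ((lam j != 0) && (sk ^+ 2 <= lam j)) -> lam j <= sk1 ^+ 2.
  rewrite negb_and negbK => /orP[/eqP->|]; first by rewrite sqr_ge0.
  rewrite -ltNge; have [i ->] := lamE j => lt.
  rewrite ler_sqr ?nnegrE ?reP // -lecR /sk1 -!nthR /singval /=.
  have nth_mono a b : (a <= b)%N -> nth 0 sv b <= nth 0 sv a.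
    move=> ab; have [bv|bv] := ltnP b (size sv); last by rewrite (nth_default _ bv).
    apply: (sorted_leq_nth _ _ _ srt) => //; rewrite ?inE ?(leq_ltn_trans ab) //.
    by move=> x y z yx zy; apply: le_trans zy yx.
  rewrite nth_mono // leqNgt; apply/negP => ik; move: lt; apply/negP.
  rewrite -leNgt ler_sqr ?nnegrE ?reP // -lecR -!nthR.
  by apply: nth_mono; rewrite -ltnS prednK.
(* [E] is the spectrum of G'. The test [lam j != 0] keeps the inverse meaningful when s_k = 0. The
   existential makes [E] opaque to rewriting. *)
have [E EE] : exists E : 'I_p -> R, forall j,
    E j = if (lam j != 0) && (sk ^+ 2 <= lam j) then (lam j)^-1 else 0.
  by exists (fun j => if (lam j != 0) && (sk ^+ 2 <= lam j) then (lam j)^-1 else 0).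
have PPt : P *m P^t* = 1%:M by apply/unitarymxP.
have sand e f : P^t* *m rdiag e *m P *m (P^t* *m rdiag f *m P)
    = P^t* *m rdiag (fun j => e j * f j) *m P.
  by rewrite -rdiagM -!mulmxA (mulmxA P) PPt mul1mx.
have [Gp GpE] : exists A, A = P^t* *m rdiag E *m P.
  exact: (ex_intro _ (P^t* *m rdiag E *m P) erefl).
have GpH : Gp^t* = Gp by rewrite GpE !adjM trmxCK rdiag_adj mulmxA.
have GpGGp : Gp *m G *m Gp = Gp.
  rewrite GpE GE !sand; congr (_ *m _ *m _); rewrite /rdiag; congr diag_mx.
  apply/rowP => j; rewrite !mxE EE; case: ifP => [/andP[l0 _]|]; last by rewrite !mul0r.
  by rewrite mulVf ?mul1r.
have [Dl DlE] : exists A, A = M^t* *m (Gp *m M).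
  exact: (ex_intro _ (M^t* *m (Gp *m M)) erefl).
have DH : Dl^t* = Dl by rewrite DlE !adjM trmxCK GpH mulmxA.
have DD : Dl *m Dl = Dl.
  by rewrite DlE -[RHS]/(_ *m _) -{3}GpGGp /G !mulmxA.
have ripD x y : rip (Dl *m x) (Dl *m y) = rip x (Dl *m y).
  by rewrite rip_adj DH mulmxA DD.
have ripP (x y : 'cV[C]_p) : rip x (P^t* *m y) = rip (P *m x) y by rewrite rip_adj.
have PUr (x : 'cV[C]_p) : rip (P *m x) (P *m x) = rip x x by rewrite rip_unitary.
exists Dl; split=> //.
(* Since D = M^* G' M is a projector, |D x|^2 = <M x, G' M x>, and s_k^2 G' has all its eigenvalues
   at most 1. *)
- move=> x; rewrite ripD DlE -!mulmxA -rip_adj GpE -!mulmxA ripP -[leRHS]PUr -[leRHS]mul1r.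
  move: (P *m (M *m x)) => z.
  have -> : sk ^+ 2 * rip z (rdiag E *m z) = rip z (rdiag (fun j => sk ^+ 2 * E j) *m z).
    by rewrite !rip_rdiag mulr_sumr; apply: eq_bigr => j _; rewrite mulrA.
  apply: rip_rdiag_le => j; rewrite EE; case: ifP => [/andP[l0 le]|]; last by rewrite mulr0.
  by rewrite ler_pdivrMr ?mul1r // lt_def l0 lam0.
- by move=> x Mx; rewrite DlE -!mulmxA Mx !mulmx0.
move=> u g gE.
(* For g = M^* u this difference is <u, (G - G G' G) u>, and G - G G' G has eigenvalue 0 where
   [lam j] is kept and [lam j] where it is discarded. *)
have -> : rip (g - Dl *m g) (g - Dl *m g) = rip g g - rip g (Dl *m g).
  by rewrite !ripBr !ripBl ripD (ripC (Dl *m g) g); ring.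
rewrite {}gE.
have -> : rip (M^t* *m u) (M^t* *m u) - rip (M^t* *m u) (Dl *m (M^t* *m u))
   = rip u ((G - G *m Gp *m G) *m u).
  by rewrite !rip_adj trmxCK DlE mulmxBl ripBr /G !mulmxA.
have -> : G - G *m Gp *m G = P^t* *m rdiag (fun j => lam j - lam j * E j * lam j) *m P.
  rewrite -(rdiagB lam (fun j => lam j * E j * lam j)) mulmxBr mulmxBl.
  by rewrite GpE GE !sand.
rewrite -!mulmxA ripP -[rip u u]PUr; apply: rip_rdiag_le => j; rewrite EE.
case: ifP => [/andP[l0 _]|/negbT/lamK]; last by rewrite mulr0 mul0r subr0.
by rewrite mulfV // mul1r subrr sqr_ge0.
Qed.
End TruncatedProjector.

(** * Simulating the controlled walk in the query model *)

Section Circuit.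
Variables (R : realType) (n m : nat) (i0 : 'I_n).
Local Notation C := R[i].
Local Notation d := #|{: Hidx n m}|.

(** The left summand holds |k>|b>; the right one holds the ancilla when the remaining state is
    |hat0>. *)
Definition wdim := #|{: ('I_m * bool) + bool}|.
Local Notation S := (qdim n wdim).

Lemma qdim_wdim : qdim n wdim = (4 * n * m.+1)%N.
Proof.
by rewrite /qdim /wdim !card_prod !card_sum !card_prod !card_ord !card_bool -addn1; ring.
Qed.

(* The ancilla q is the answer bit in the Hadamard basis, where the oracle acts
   on |i>|q> as the phase (-1)^(q x_i); |hat0> must see no phase for either
   value of q, so there q is moved to the workspace and the answer bit is |+>. *)
Definition enc (q : bool) (h : Hidx n m) : qidx n wdim :=
  match h with
  | None => (i0, false, enum_rank (inr q))
  | Some (i, k, b) => (i, q, enum_rank (inl (k, b)))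
  end.

Lemma enc_inj q q' h h' : enc q h = enc q' h' -> q = q' /\ h = h'.
Proof.
case: h h' => [[[i k] b]|] [[[i' k'] b']|] //= [].
- by move=> -> -> /enum_rank_inj[-> ->].
- by move=> _ _ /enum_rank_inj.
- by move=> _ _ /enum_rank_inj.
- by move=> /enum_rank_inj[->].
Qed.

Definition slot (j : 'I_(d + d)) : 'I_S :=
  enum_rank (match split j with
             | inl h => enc false (enum_val h)
             | inr h => enc true (enum_val h) end).

Lemma slot_inj : injective slot.
Proof.
move=> j j' /enum_rank_inj E; apply: (can_inj splitK).
by move: E; case: (split j) (split j') => h [] h' /enc_inj[] // _ /enum_val_inj ->.
Qed.

Definition embed : 'M[C]_(S, d + d) := \matrix_(a, j) (a == slot j)%:R.

Lemma embedK : embed^t* *m embed = 1%:M.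
Proof.
apply/matrixP => j j'; rewrite !mxE (bigD1 (slot j)) //= !mxE eqxx rmorph1 mul1r.
rewrite big1 ?addr0 => [|a /negbTE aj]; last by rewrite !mxE aj rmorph0 mul0r.
by rewrite (inj_eq slot_inj).
Qed.

Lemma embedE (u : 'cV[C]_(d + d)) j : (embed *m u) (slot j) 0 = u j 0.
Proof.
rewrite !mxE (bigD1 j) //= !mxE eqxx mul1r big1 ?addr0 // => j' /negbTE jj.
by rewrite mxE (inj_eq slot_inj) eq_sym jj mul0r.
Qed.

(** L on the image of the isometry [embed], the identity on its orthogonal complement. *)
Definition lift_mx (L : 'M[C]_(d + d)) : 'M[C]_S :=
  embed *m L *m embed^t* + (1%:M - embed *m embed^t*).

Lemma lift_mx_embed L : lift_mx L *m embed = embed *m L.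
Proof.
rewrite /lift_mx mulmxDl mulmxBl -!mulmxA embedK !mulmx1 mul1mx.
by rewrite subrr addr0.
Qed.

Lemma lift_mx_unitary L : L \is unitarymx -> lift_mx L \is unitarymx.
Proof.
move=> /unitarymxP LL; apply/unitarymxP.
have -> : (lift_mx L)^t* = embed *m L^t* *m embed^t* + (1%:M - embed *m embed^t*).
  rewrite /lift_mx; move: embed => E.
  rewrite linearD linearB /= map_mxD map_mxB trmx1 map_mx1.
  by rewrite !adjM !trmxCK mulmxA.
rewrite mulmxDr mulmxBr mulmx1 !mulmxA !lift_mx_embed.
rewrite -(mulmxA _ L) LL mulmx1 /lift_mx.
by rewrite [X in _ + (X - _)]addrC addrK addrC subrK.
Qed.

Definition zsign (t : qidx n wdim) : C := (-1) ^+ t.1.2.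

Definition zmx : 'M[C]_S := diag_mx (\row_a zsign (enum_val a)).

Lemma qflipK (x : bits n) : involutive (@qflip n wdim x).
Proof. by case=> [[i b] k] /=; rewrite addbK. Qed.

Lemma oracle_mulE (x : bits n) p (A : 'M[C]_(S, p)) a b :
  (oracle R wdim x *m A) a b = A (enum_rank (qflip x (enum_val a))) b.
Proof.
rewrite mxE (bigD1 (enum_rank (qflip x (enum_val a)))) //= mxE.
rewrite enum_rankK qflipK eqxx mul1r big1 ?addr0 // => c ca; rewrite mxE.
case: eqP => [ac|]; last by rewrite mul0r.
by rewrite ac qflipK enum_valK eqxx in ca.
Qed.

(** The Hadamard gate (X + Z) / sqrt 2 on the answer bit; the Pauli X is the oracle of the all-ones
    string. *)
Definition had : 'M[C]_S :=
  ((Num.sqrt 2)^-1)%:C%C *: (oracle R wdim [ffun=> true] + zmx).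

Lemma had_adj : had^t* = had.
Proof.
apply/matrixP => a b; rewrite !mxE rmorphM rmorphD /= conj_conjc conjc_real.
congr (_ * (_ + _)).
  rewrite conjC_nat; congr (_%:R).
  by rewrite -(inj_eq (inv_inj (qflipK [ffun=> true]))) qflipK eq_sym.
rewrite rmorphMn /= eq_sym; case: eqP => // ->.
by rewrite /zsign rmorphXn rmorphN rmorph1.
Qed.

(** X and Z are anticommuting involutions, so (X + Z)^2 = 2. *)
Lemma hadK : had *m had = 1%:M.
Proof.
rewrite /had -scalemxAl -scalemxAr scalerA -rmorphM -expr2 exprVn sqr_sqrtr //=.
set X := oracle R wdim _.
have XX : X *m X = 1%:M.
  apply/matrixP => a b; rewrite oracle_mulE !mxE enum_rankK.
  by rewrite (inj_eq (inv_inj (qflipK _))) (inj_eq enum_val_inj).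
have ZZ : zmx *m zmx = 1%:M.
  rewrite /zmx mulmx_diag -diag_const_mx; congr diag_mx.
  by apply/rowP => a; rewrite !mxE -expr2 sqrr_sign.
have XZ : X *m zmx = - (zmx *m X).
  apply/matrixP => a b; rewrite oracle_mulE mxE mul_diag_mx !mxE.
  rewrite -!(inj_eq enum_val_inj) enum_rankK.
  have -> : zsign (qflip [ffun=> true] (enum_val a)) = - zsign (enum_val a).
    case: (enum_val a) => [[i e] k]; rewrite /zsign /= ffunE.
    by case: e; rewrite /= ?opprK.
  rewrite mulNrn mulr_natr; congr (- (_ *+ (nat_of_bool _))).
  by rewrite -(inj_eq (inv_inj (qflipK [ffun=> true]))) qflipK.
rewrite mulmxDl !mulmxDr XX ZZ XZ addrA subrK -mulr2n.
rewrite -scaler_nat scalerA -(rmorph_nat (real_complex R)) -rmorphM mulVf ?pnatr_eq0 //.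
by rewrite rmorph1 scale1r.
Qed.

Lemma had_unitary : had \is unitarymx.
Proof. by apply/unitarymxP; rewrite had_adj hadK. Qed.

Definition phase (x : bits n) (h : Hidx n m) : C :=
  if h is Some (i, _, _) then (-1) ^+ x i else 1.

Definition phase_mx (x : bits n) : 'M[C]_d := diag_mx (\row_h phase x (enum_val h)).

Definition qphase_mx (x : bits n) : 'M[C]_S :=
  diag_mx (\row_a (-1) ^+ ((enum_val a).1.2 && x (enum_val a).1.1)).

(** Phase kickback: where x_i = 1 the oracle is X on the answer bit, and the Hadamard gate turns X
    into Z. *)
Lemma oracle_had x : oracle R wdim x *m had = had *m qphase_mx x.
Proof.
rewrite /had -scalemxAr -scalemxAl; congr (_ *: _).
apply/matrixP => a b; rewrite oracle_mulE mul_mx_diag !mxE enum_rankK.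
rewrite -!(inj_eq enum_val_inj) enum_rankK.
move: (enum_val a) (enum_val b) => [[i e] k] [[i' e'] k'].
rewrite /zsign /= !xpair_eqE /= ffunE.
have [<-|_] := eqVneq i i'; last by rewrite /= !mulr0n addr0 mul0r.
have [_|_] := eqVneq k k'; last by rewrite !andbF !mulr0n addr0 mul0r.
by case: (x i) e e' => [] [] [] /=;
  rewrite ?(mulr0n, mulr1n, expr0, expr1, addr0, add0r, mulr1, mul1r);
  rewrite ?(mulrN1, opprK, mulrNN).
Qed.

(** [enc] sets the answer bit exactly when the ancilla is |1> and the state is not |hat0>, so the
    query phase is the phase controlled by the ancilla. *)
Lemma qphase_embed x : qphase_mx x *m embed = embed *m ctrl (phase_mx x).
Proof.
rewrite /ctrl /phase_mx -diag_const_mx -diag_mx_row.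
apply/matrixP => a j; rewrite mul_diag_mx mul_mx_diag !mxE.
case: (eqVneq a (slot j)) => [->|_]; last by rewrite mulr0 mul0r.
rewrite mulr1 mul1r /slot enum_rankK.
case: split => h; rewrite !mxE; case: (enum_val h) => [[[i k] b]|] //=.
Qed.

Definition hat0 : 'cV[C]_d := \col_h (h == enum_rank None)%:R.

Definition t_init : 'I_S := slot (lshift d (enum_rank None)).

Lemma embed_init : embed *m col_mx hat0 0 = basis_vec R t_init.
Proof.
apply/colP => a; rewrite !mxE big_split_ord /=.
rewrite [X in _ + X]big1 ?addr0 => [|h _]; last first.
  by rewrite col_mxEd !mxE mulr0.
rewrite (bigD1 (enum_rank None)) //= big1 ?addr0 => [|h /negbTE h0].
  by rewrite col_mxEu !mxE eqxx mulr1.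
by rewrite col_mxEu !mxE h0 mulr0.
Qed.

Variables (L : 'M[C]_(d + d)) (T : nat).

Definition walk (x : bits n) t : 'cV[C]_(d + d) :=
  iter t (mulmx (L *m ctrl (phase_mx x))) (col_mx hat0 0).

(** Each query is sandwiched between Hadamard gates. The last step omits the outgoing gate, so that
    the measurement reads the ancilla directly. *)
Definition circuit (t : nat) : 'M[C]_S :=
  (if (t < T)%N then had else 1%:M) *m (if t is 0 then 1%:M else lift_mx L *m had).

Definition accept_set : {set 'I_S} := [set slot (rshift d h) | h in 'I_d].

Lemma qstate_circuit x t : (t <= T)%N -> qstate circuit t_init x t =
  (if (t < T)%N then had else 1%:M) *m (embed *m walk x t).
Proof.
elim: t => [_|t IH tT].
  by rewrite /= /circuit mulmx1 embed_init.
rewrite [LHS]/= (IH (ltnW tT)) tT [walk x t.+1]/=; move: (walk x t) => y.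
rewrite /circuit -!mulmxA; congr (_ *m _).
rewrite (mulmxA (oracle _ _ _)) oracle_had -(mulmxA had) (mulmxA had had) hadK.
rewrite mul1mx (mulmxA (qphase_mx x)) qphase_embed -(mulmxA embed).
by rewrite (mulmxA (lift_mx L)) lift_mx_embed -mulmxA.
Qed.

Hypothesis LU : L \is unitarymx.

Lemma circuit_unitary t : circuit t \is unitarymx.
Proof.
have U1 : (1%:M : 'M[C]_S) \is unitarymx.
  by apply/unitarymxP; rewrite trmx1 map_mx1 mulmx1.
rewrite /circuit; apply: mul_unitarymx.
  by case: ifP => _; [exact: had_unitary | exact: U1].
case: t => [|t]; first exact: U1.
by apply: mul_unitarymx; [exact: lift_mx_unitary | exact: had_unitary].
Qed.

(** Accepting means finding the ancilla in |1>. Since [embed] is an isometry, the complementary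
    outcome carries the rest of the norm, which is the upper block. *)
Lemma outprob_circuit x b : outprob T circuit t_init accept_set x b =
  (rip (if b then dsubmx (walk x T) else usubmx (walk x T))
       (if b then dsubmx (walk x T) else usubmx (walk x T)))%:C%C.
Proof.
rewrite /outprob qstate_circuit // ltnn mul1mx; set y := walk x T.
have accE : \sum_(a in accept_set) `|(embed *m y) a 0| ^+ 2
            = (rip (dsubmx y) (dsubmx y))%:C%C.
  rewrite big_imset /=; last by move=> h h' _ _ /slot_inj/rshift_inj.
  by rewrite rip_sqnorm; apply: eq_bigr => h _; rewrite embedE mxE.
case: b; first by rewrite -accE; apply: eq_bigl => a; rewrite eqb_id.
have : \sum_a `|(embed *m y) a 0| ^+ 2 = (rip y y)%:C%C.
  by rewrite -rip_sqnorm rip_adj mulmxA embedK mul1mx.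
have := rip_col_mx (usubmx y) (usubmx y) (dsubmx y) (dsubmx y).
rewrite vsubmxK => ->; rewrite (bigID (mem accept_set)) /= accE rmorphD /=.
rewrite addrC => /addIr <-; apply: eq_bigl => a.
by rewrite eqbF_neg.
Qed.

End Circuit.

(** * The vectors of the span program and their projections *)

Section AdversaryVectors.
Variables (R : realType) (n m : nat).
Local Notation C := R[i].
Local Notation d := #|{: Hidx n m}|.

Definition colH (F : Hidx n m -> C) : 'cV[C]_d := \col_h F (enum_val h).

Lemma sum_enum_val (T : finType) (F : T -> C) :
  \sum_(j < #|{: T}|) F (enum_val j) = \sum_t F t.
Proof.
by rewrite [RHS](reindex (@enum_val T predT)) //; apply: onW_bij; apply: enum_val_bij.
Qed.

Lemma sum_Hidx (F : Hidx n m -> C) :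
  \sum_h F h = F None + \sum_i \sum_k \sum_b F (Some (i, k, b)).
Proof.
rewrite (bigD1 None) //=; congr (_ + _).
rewrite (reindex_omap Some id) => [|[]] //=.
rewrite !pair_big /=; apply: eq_big => [t|[[i k] b] _] //.
by rewrite eqxx.
Qed.

(** Common shape of |hat0> and of the unnormalised |psi_x> and |phi_x>: e is the amplitude on
    |hat0>, z selects the last qubit. *)
Definition qvec (e al : C) (u : 'I_n -> 'rV[C]_m) (z : 'I_n -> bool) (h : Hidx n m) : C :=
  if h is Some (i, k, b) then al * u i 0 k * (b == z i)%:R else e.

Lemma rip_qvec e al u z : (rip (colH (qvec e al u z)) (colH (qvec e al u z)))%:C%C
  = `|e| ^+ 2 + `|al| ^+ 2 * \sum_i sqnorm (u i).
Proof.
rewrite rip_sqnorm; under eq_bigr => h _ do rewrite mxE.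
rewrite (sum_enum_val (fun h => `|qvec e al u z h| ^+ 2)) sum_Hidx /=; congr (_ + _).
rewrite mulr_sumr; apply: eq_bigr => i _; rewrite /sqnorm mulr_sumr.
apply: eq_bigr => k _; rewrite (bigD1 (z i)) //= eqxx mulr1 normrM exprMn.
by rewrite big1 ?addr0 // => b /negbTE ->; rewrite mulr0 normr0 expr0n.
Qed.

Lemma colHB F G : colH F - colH G = colH (fun h => F h - G h).
Proof. by apply/colP => h; rewrite !mxE. Qed.

Lemma hat0E : hat0 R n m = colH (qvec 1 0 (fun=> 0) (fun=> false)).
Proof.
apply/colP => h; rewrite !mxE -(inj_eq enum_val_inj) enum_rankK.
by case: (enum_val h) => [[[i k] b]|] //=; rewrite mul0r mul0r.
Qed.

Definition zphase_mx : 'M[C]_d :=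
  diag_mx (\row_h (if enum_val h is Some (_, _, b) then (-1) ^+ (b : bool) else 1)).

(** This is 2 Pi_x - 1, factored into a sign independent of x and the phase given by a single
    query. *)
Definition refl_mx (x : bits n) : 'M[C]_d := zphase_mx *m phase_mx R m x.

Lemma refl_mxE x F : refl_mx x *m colH F = colH (fun h =>
  (if h is Some (i, _, b) then (-1) ^+ (b (+) x i) else 1) * F h).
Proof.
apply/colP => h; rewrite /refl_mx /zphase_mx /phase_mx -mulmxA.
rewrite !mul_diag_mx !mxE /phase mulrA.
by case: (enum_val h) => [[[i k] b]|]; rewrite ?mul1r // signr_addb.
Qed.

Lemma diag_sign_unitary N (e : 'rV[C]_N) : (forall j, `|e 0 j| = 1) ->
  diag_mx e \is unitarymx.
Proof.
move=> e1; apply/unitarymxP; rewrite tr_diag_mx map_diag_mx mulmx_diag.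
rewrite -diag_const_mx; congr diag_mx; apply/rowP => j.
by rewrite !mxE -normCK e1 expr1n.
Qed.

Lemma zphase_unitary : zphase_mx \is unitarymx.
Proof.
apply: diag_sign_unitary => j; rewrite mxE.
by case: (enum_val j) => [[[i k] b]|]; rewrite ?normr1 // normr_sign.
Qed.

Lemma phase_unitary (x : bits n) : phase_mx R m x \is unitarymx.
Proof.
apply: diag_sign_unitary => j; rewrite mxE /phase.
by case: (enum_val j) => [[[i k] b]|]; rewrite ?normr1 // normr_sign.
Qed.

Lemma refl_unitary x : refl_mx x \is unitarymx.
Proof. by rewrite mul_unitarymx ?zphase_unitary ?phase_unitary. Qed.

Lemma refl_fixed (x : bits n) e al u :
  refl_mx x *m colH (qvec e al u x) = colH (qvec e al u x).
Proof.
rewrite refl_mxE; apply/colP => h; rewrite !mxE.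
case: (enum_val h) => [[[i k] b]|] /=; last by rewrite mul1r.
by case: eqP => [->|]; rewrite ?mulr0 // addbb mul1r.
Qed.

(** Every component of w other than |hat0> has last qubit different from x_i, so it changes sign. *)
Lemma refl_flipped (x : bits n) al u (w := colH (qvec 1 al u (fun i => ~~ x i))) :
  refl_mx x *m w = 2 *: hat0 R n m - w.
Proof.
rewrite /w refl_mxE hat0E; apply/colP => h; rewrite !mxE.
case: (enum_val h) => [[[i k] b]|] /=; last by ring.
by case: eqP => [->|_]; rewrite ?addNb ?addbb /= ?expr1; ring.
Qed.

Section Family.
Variables (X : {set bits n}) (v : bits n -> 'I_n -> 'rV[C]_m).
Let A := sizeA X v.
Let c := cconst R.

Definition vsum (x : bits n) : C := \sum_(i < n) sqnorm (v x i).

Lemma vsum_ge0 x : 0 <= vsum x.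
Proof. by rewrite !sumr_ge0 // => i _; rewrite sumr_ge0 // => k _; rewrite exprn_ge0. Qed.

Lemma bigmax_real_ge0 (I : finType) (P : pred I) (F : I -> C) :
  (forall i, P i -> 0 <= F i) -> 0 <= \big[Num.max/0]_(i | P i) F i.
Proof.
move=> F0; apply: (big_ind (fun z => 0 <= z)) => // z y z0 y0.
by rewrite /Order.max; case: ifP.
Qed.

(** The order of C is partial; comparability with the running maximum comes from all terms being
    nonnegative reals. *)
Lemma le_bigmax_real (I : finType) (P : pred I) (F : I -> C) j :
  (forall i, P i -> 0 <= F i) -> P j -> F j <= \big[Num.max/0]_(i | P i) F i.
Proof.
move=> F0 Pj; rewrite -big_filter; have : j \in [seq i <- index_enum I | P i].
  by rewrite mem_filter Pj mem_index_enum.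
have : all P [seq i <- index_enum I | P i].
  by apply/allP => i; rewrite mem_filter => /andP[].
elim: [seq _ <- _ | _] => // i s IH /= /andP[Pi Ps]; rewrite big_cons in_cons.
have s0 : 0 <= \big[Num.max/0]_(i <- s) F i.
  elim: (s) Ps => [|i' s' IH'] /=; first by rewrite big_nil.
  by move=> /andP[Pi' /IH' ?]; rewrite big_cons /Order.max; case: ifP => // _; apply: F0.
have cmp := real_comparable (ger0_real (F0 i Pi)) (ger0_real s0).
case/predU1P => [->|/(IH Ps) le]; first by rewrite comparable_le_max ?lexx.
by rewrite comparable_le_max // le orbT.
Qed.

Lemma vsum_le x : x \in X -> vsum x <= A.
Proof. by apply: (@le_bigmax_real _ (mem X)) => y _; apply: vsum_ge0. Qed.

Hypothesis A1 : 1 <= A.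

Let A0 : 0 < A. Proof. exact: lt_le_trans A1. Qed.
Let c0 : 0 < c. Proof. by rewrite ltr0n. Qed.
Let cA0 : 0 < c * A. Proof. exact: mulr_gt0. Qed.

Lemma nu_gt0 x : 0 < nu X v x.
Proof. by rewrite ltr_wpDr ?ltr01 // mulr_ge0 ?vsum_ge0 // invr_ge0 ltW. Qed.

Lemma mu_gt0 x : 0 < mu X v x.
Proof. by rewrite ltr_wpDr ?ltr01 // mulr_ge0 ?vsum_ge0 // ltW. Qed.

(* sqrt(nu) |psi_x> and sqrt(mu) |phi_x>, whose |hat0>-component is exactly 1. *)
Definition gvec x := colH (qvec 1 (sqrtC (c * A))^-1 (v x) x).
Definition wvec x := colH (qvec 1 (- sqrtC (c * A)) (v x) (fun i => ~~ x i)).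

Lemma psiE x h : psi X v x h =
  (sqrtC (nu X v x))^-1 * qvec 1 (sqrtC (c * A))^-1 (v x) x h.
Proof. by case: h => [[[i k] b]|] /=; rewrite ?mulr1 // !mulrA. Qed.

Lemma phiE x h : phi X v x h =
  (sqrtC (mu X v x))^-1 * qvec 1 (- sqrtC (c * A)) (v x) (fun i => ~~ x i) h.
Proof. by case: h => [[[i k] b]|] /=; rewrite ?mulr1 // !mulNr mulrN !mulrA. Qed.

Lemma rip_wvec x : (rip (wvec x) (wvec x))%:C%C = mu X v x.
Proof.
rewrite rip_qvec normr1 expr1n normrN -normrX sqrtCK ger0_norm //.
exact: ltW.
Qed.

Lemma rip_gvec x : (rip (gvec x) (gvec x))%:C%C = nu X v x.
Proof.
rewrite rip_qvec normr1 expr1n -normrX exprVn sqrtCK ger0_norm // invr_ge0.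
exact: ltW.
Qed.

Lemma rip_gvec_hat0 x : (rip (gvec x - hat0 R n m) (gvec x - hat0 R n m))%:C%C
  = (c * A)^-1 * vsum x.
Proof.
have -> : gvec x - hat0 R n m = colH (qvec 0 (sqrtC (c * A))^-1 (v x) x).
  rewrite hat0E colHB; apply/colP => h; rewrite !mxE.
  by case: (enum_val h) => [[[i k] b]|] /=; rewrite ?subrr // !mul0r subr0.
rewrite rip_qvec normr0 expr0n add0r -normrX exprVn sqrtCK ger0_norm // invr_ge0.
exact: ltW.
Qed.

Variable f : bits n -> bool.
Let M := Mmat X f v.

(** This is the form g = M^* u required by the last clause of [truncated_projector]; here |u|^2 =
    nu. *)
Lemma gvec_row r : gvec (enum_val r) =
  M^t* *m (sqrtC (nu X v (enum_val r)) *: basis_vec R r).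
Proof.
rewrite -scalemxAr; apply/colP => h; rewrite !mxE (bigD1 r) //= !mxE eqxx mulr1.
rewrite conjCK big1 ?addr0 => [|r' /negbTE r0]; last by rewrite !mxE r0 mulr0.
by rewrite psiE mulVKf // sqrtC_eq0 gt_eqF ?nu_gt0.
Qed.

Lemma rip_scale_basis p (r : 'I_p) (z : C) : 0 <= z ->
  (rip (sqrtC z *: basis_vec R r) (sqrtC z *: basis_vec R r))%:C%C = z.
Proof.
move=> z0; rewrite rip_sqnorm (bigD1 r) //= !mxE eqxx mulr1 -normrX sqrtCK.
rewrite ger0_norm // big1 ?addr0 // => r' /negbTE r0.
by rewrite !mxE r0 mulr0 normr0 expr0n.
Qed.

Lemma Mmat_wvec y r : (M *m wvec y) r 0 =
  sqrtC (mu X v y) * braket X v (enum_val r) y.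
Proof.
rewrite mxE /braket mulr_sumr -[RHS]sum_enum_val; apply: eq_bigr => h _.
by rewrite !mxE phiE mulrCA mulVKf // sqrtC_eq0 gt_eqF ?mu_gt0.
Qed.

Lemma braket_le_epsilon x y : x \in X1 X f -> y \in X0 X f ->
  `|braket X v x y| <= epsilon X f v.
Proof.
move=> xX yX; pose F x := \big[Num.max/0]_(y in X0 X f) `|braket X v x y|.
have F0 z : z \in X1 X f -> 0 <= F z by move=> _; apply: bigmax_real_ge0.
apply: le_trans (le_bigmax_real F0 xX).
by apply: (@le_bigmax_real _ (mem (X0 X f)) (fun y => `|braket X v x y|)).
Qed.

Lemma rip_Mmat_wvec y : y \in X0 X f ->
  (rip (M *m wvec y) (M *m wvec y))%:C%C <=
  #|X1 X f|%:R * (mu X v y * epsilon X f v ^+ 2).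
Proof.
move=> yX; rewrite rip_sqnorm mulr_natl -[X in _ *+ X]card_ord -sumr_const.
apply: ler_sum => r _; rewrite Mmat_wvec normrM exprMn -normrX sqrtCK.
rewrite (gtr0_norm (mu_gt0 _)) ler_wpM2l ?(ltW (mu_gt0 _)) //.
have le_eps := braket_le_epsilon (enum_valP r) yX.
by rewrite lerXn2r ?nnegrE // (le_trans _ le_eps).
Qed.

Variable a : R.
Hypothesis AE : A = a%:C%C.

Let a0 : 0 < a. Proof. by move: A0; rewrite AE ltcR. Qed.
Let cE : c = (100 : R)%:C%C. Proof. by rewrite rmorph_nat. Qed.

Lemma rip_gvec_hat0_le x : x \in X ->
  rip (gvec x - hat0 R n m) (gvec x - hat0 R n m) <= 1 / 100.
Proof.
move=> xX; rewrite -lecR rip_gvec_hat0 invfM -mulrA.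
have -> : ((1 / 100 : R))%:C%C = c^-1 * 1 by rewrite mulr1 div1r fmorphV cE.
by rewrite ler_wpM2l ?invr_ge0 ?(ltW c0) // mulrC ler_pdivrMr // mul1r vsum_le.
Qed.

Lemma nu_le x : x \in X -> nu X v x <= (101 / 100 : R)%:C%C.
Proof.
move=> /rip_gvec_hat0_le; rewrite -lecR rip_gvec_hat0 => le.
have -> : (101 / 100 : R) = 1 + 1 / 100 by field.
by rewrite rmorphD rmorph1 lerD2l.
Qed.

Lemma rip_gvec_le x : x \in X -> rip (gvec x) (gvec x) <= 101 / 100.
Proof. by move=> /nu_le; rewrite -lecR rip_gvec. Qed.

Lemma rip_wvec_le x : x \in X -> rip (wvec x) (wvec x) <= 101 * a ^+ 2.
Proof.
move=> xX; have a1 : 1 <= a by move: A1; rewrite AE lecR.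
have : rip (wvec x) (wvec x) <= 1 + 100 * a * a.
  rewrite -lecR rip_wvec !rmorphD rmorph1 !rmorphM /= -cE -AE lerD2l.
  by rewrite ler_wpM2l ?(ltW cA0) // vsum_le.
by move=> /le_trans -> //; nra.
Qed.

(** The bound is |u|^2 = nu <= 101/100 times s_(k+1)^2 <= 1 / (4 * 1000 c A^2), with c = 100. *)
Lemma rip_gvec_proj_le (D : 'M[C]_d) (sg : R) x : x \in X1 X f ->
  (forall (u : 'cV[C]_#|X1 X f|) (g : 'cV[C]_d), g = M^t* *m u ->
     rip (g - D *m g) (g - D *m g) <= sg ^+ 2 * rip u u) ->
  sg%:C%C <= (2 * sqrtC (1000 * c) * A)^-1 -> 0 <= sg ->
  rip (gvec x - D *m gvec x) (gvec x - D *m gvec x)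
    <= (101 / 100) / (400 * 1000 * a ^+ 2).
Proof.
move=> xX1 Dg sg_le sg0.
have xX : x \in X by move: xX1; rewrite inE => /andP[].
pose r := enum_rank_in xX1 x; have rx : enum_val r = x by apply: enum_rankK_in.
have := Dg _ _ (gvec_row r); rewrite rx => /le_trans -> //.
have : rip (sqrtC (nu X v x) *: basis_vec R r)
           (sqrtC (nu X v x) *: basis_vec R r) <= 101 / 100.
  by rewrite -lecR rip_scale_basis ?(ltW (nu_gt0 _)) ?nu_le.
have : sg ^+ 2 <= (400 * 1000 * a ^+ 2)^-1.
  rewrite -lecR rmorphXn fmorphV [X in _ <= X^-1]rmorphM rmorphXn rmorphM !rmorph_nat /= -AE.
  apply: (@le_trans _ _ ((2 * sqrtC (1000 * c) * A)^-1 ^+ 2)).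
    rewrite lerXn2r ?nnegrE ?ler0c // invr_ge0 !mulr_ge0 ?sqrtC_ge0 //.
      by rewrite mulr_ge0 ?(ltW c0).
    exact: ltW.
  rewrite exprVn exprMn (exprMn _ 2) sqrtCK.
  suff E : 2 ^+ 2 * (1000 * c) = 400 * 1000 by rewrite E.
  by rewrite /c /cconst; ring.
move=> H1 H2; rewrite mulrC; apply: ler_pM => //; first exact: rip_ge0.
exact: sqr_ge0.
Qed.

(** The n_1 entries of M w have modulus at most sqrt(mu) epsilon, and sqrt(n_1) epsilon <= s_k / (2
    sqrt(c) A); with mu <= 101 A^2 this gives |M w|^2 <= s_k^2 * 101/400, and D costs a factor 1 /
    s_k^2. *)
Lemma rip_wvec_proj_le (D : 'M[C]_d) (sg sg1 : R) y : y \in X0 X f ->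
  (forall x : 'cV[C]_d, sg ^+ 2 * rip (D *m x) (D *m x) <= rip (M *m x) (M *m x)) ->
  (forall x : 'cV[C]_d, M *m x = 0 -> D *m x = 0) ->
  (0 < #|X1 X f|)%N -> 0 <= sg -> 0 <= sg1 ->
  epsilon X f v <= (sqrtC #|X1 X f|%:R)^-1 * (sg%:C%C / (2 * sqrtC c * A) - sg1%:C%C) ->
  rip (D *m wvec y) (D *m wvec y) <= 101 / 400.
Proof.
move=> yX0 Dsg D0 n1 sg0 sg10 eps_le.
have yX : y \in X by move: yX0; rewrite inE => /andP[].
have n10 : 0 < sqrtC #|X1 X f|%:R :> C by rewrite sqrtC_gt0 ltr0n.
have e0 : 0 <= epsilon X f v.
  by apply: bigmax_real_ge0 => x _; apply: bigmax_real_ge0.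
have Mw : rip (M *m wvec y) (M *m wvec y) <= sg ^+ 2 * (101 / 400).
  have w2 := rip_wvec_le yX.
  have : rip (M *m wvec y) (M *m wvec y)
      <= rip (wvec y) (wvec y) * (sg ^+ 2 / (400 * a ^+ 2)).
    rewrite -lecR (le_trans (rip_Mmat_wvec yX0)) // mulrCA rmorphM /= rip_wvec.
    rewrite ler_wpM2l ?(ltW (mu_gt0 _)) //.
    have -> : #|X1 X f|%:R * epsilon X f v ^+ 2
      = (sqrtC #|X1 X f|%:R * epsilon X f v) ^+ 2 by rewrite exprMn sqrtCK.
    have den0 : 0 < 2 * sqrtC c * A by rewrite !mulr_gt0 ?sqrtC_gt0.
    apply: (@le_trans _ _ ((sg%:C%C / (2 * sqrtC c * A)) ^+ 2)).
      rewrite lerXn2r ?nnegrE ?mulr_ge0 ?(ltW n10) ?ler0c ?invr_ge0 ?(ltW den0) //.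
      rewrite -(ler_pM2l n10) mulVKf ?gt_eqF // in eps_le.
      by apply: le_trans eps_le _; rewrite gerBl ler0c.
    rewrite expr_div_n exprMn (exprMn _ 2) sqrtCK.
    rewrite fmorph_div rmorphXn rmorphM rmorphXn rmorph_nat /= -AE.
    suff E : 2 ^+ 2 * c = 400 by rewrite E.
    by rewrite /c /cconst; ring.
  move=> /le_trans -> //.
  have -> : sg ^+ 2 * (101 / 400) = (101 * a ^+ 2) * (sg ^+ 2 / (400 * a ^+ 2)).
    by field; rewrite gt_eqF.
  by rewrite ler_wpM2r // divr_ge0 ?sqr_ge0 // mulr_ge0 ?sqr_ge0.
(* When s_k = 0 the bound says M w = 0, and D vanishes on the kernel of M. *)
have [sgZ|sgN] := eqVneq sg 0; last first.
  have sg2 : 0 < sg ^+ 2 by rewrite exprn_gt0 // lt_def sgN.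
  by rewrite -(ler_pM2l sg2) (le_trans (Dsg _)).
rewrite D0 ?rip0r ?divr_ge0 //.
move: Mw; rewrite sgZ expr0n mul0r => Mw; apply: rip_eq0.
by apply/eqP; rewrite eq_le Mw rip_ge0.
Qed.

End Family.
End AdversaryVectors.

(** * Error analysis of the resonance experiment *)

Section PhaseDetection.
Variables (R : rcfType) (d : nat).
Local Notation C := R[i].

Lemma ctrl_col (B : 'M[C]_d) (p q : 'cV[C]_d) :
  ctrl B *m col_mx p q = col_mx p (B *m q).
Proof. by rewrite mul_block_col !mul0mx mul1mx addr0 add0r. Qed.

(** The two iterations are conjugate by [ctrl B], which fixes the initial state because its lower
    block is 0. *)
Lemma iter_rabi_shift (c s : R) (B S : 'M[C]_d) (h : 'cV[C]_d) t :
  iter t (mulmx (ctrl B *m rotmx d c s *m ctrl S)) (col_mx h 0)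
  = ctrl B *m iter t (mulmx (rabi c s (S *m B))) (col_mx h 0).
Proof.
elim: t => [|t /= ->]; first by rewrite /= ctrl_col mulmx0.
by rewrite /rabi ctrlM !mulmxA.
Qed.

Definition reflector (D : 'M[C]_d) : 'M[C]_d := D + D - 1%:M.

Lemma reflector_unitary (D : 'M[C]_d) : D^t* = D -> D *m D = D ->
  reflector D \is unitarymx.
Proof.
move=> DH DD; apply/unitarymxP.
have -> : (reflector D)^t* = reflector D.
  by rewrite /reflector linearB linearD /= map_mxB map_mxD DH trmx1 map_mx1.
rewrite /reflector mulmxBl mulmxDl mul1mx !mulmxBr !mulmxDr !mulmx1 DD.
by rewrite addrK opprB addrC subrK.
Qed.

Lemma nrm_le_sqr n (u : 'cV[C]_n) (a b : R) : 0 <= b -> rip u u <= a ->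
  a <= b ^+ 2 -> nrm u <= b.
Proof. by move=> b0 ua ab; rewrite nrm_leP // (le_trans ua). Qed.

(** Numerical budgets, decided in small contexts. The constants round square roots: 1/628 for
    sqrt(101 / (4 * 10^7)), 503/1000 for sqrt(101/400), 1005/100 for sqrt(101), 575/1000 for
    1/sqrt(3); 1000/7 is 1/(s a). *)
Let le_sqr_101 : (101 / 100 : R) <= (101 / 100) ^+ 2. Proof. lra. Qed.
Let le_sqr_10 : (1 / 100 : R) <= (1 / 10) ^+ 2. Proof. lra. Qed.
Let proj_budget (y : R) : 0 < y -> 101 / 100 * (628 ^+ 2 * y) <= 400 * 1000 * y.
Proof. by move=> y0; lra. Qed.
Let le_sqr_503 : (101 / 400 : R) <= (503 / 1000) ^+ 2. Proof. lra. Qed.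
Let time_budget : (1 : R) <= 7 / 1000 * (1000 / 7). Proof. lra. Qed.
Let drift_budget : 2 * (1000 / 7) / 628 <= 91 / 200 :> R. Proof. lra. Qed.
Let reject_budget (x y g z e s : R) :
  s <= 7 / 1000 -> z <= s * (101 / 100) * (101 / 100) ->
  y <= 1 / 10 -> e <= 91 / 200 -> g <= e -> x <= g + z + y -> x <= 57 / 100.
Proof. by move=> *; lra. Qed.
Let sqr_le_third (x : R) : 0 <= x -> x <= 575 / 1000 -> x ^+ 2 <= 1 / 3.
Proof. by move=> *; nra. Qed.
Let accept_budget (s a : R) : s * a = 7 / 1000 ->
  s * (101 / 100) * (1005 / 100 * a) + 503 / 1000 <= 575 / 1000.
Proof. by move=> *; lra. Qed.
Let cos_ge (c s : R) : 0 < c -> 0 < s -> c ^+ 2 + s ^+ 2 = 1 -> s <= 7 / 1000 ->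
  100 / 101 <= c.
Proof. by move=> *; nra. Qed.
Let le_sqr_1005 (a : R) : 101 * a ^+ 2 <= (1005 / 100) ^+ 2 * a ^+ 2.
Proof. by rewrite ler_wpM2r ?sqr_ge0 //; lra. Qed.
Let le_101_mul (c : R) : 100 / 101 <= c -> 1 <= 101 / 100 * c.
Proof. by move=> *; lra. Qed.
Let le_57_575 : (57 / 100 : R) <= 575 / 1000. Proof. lra. Qed.

(* s = 7/(1000 a) balances the two error amplitudes, which must both stay below
   1/sqrt 3 = 0.577...: 0.1 + 2 s_{k+1}/s + O(s) for f(x) = 1, which decreases
   with s, and sqrt(101) (s a + 1/20) for f(x) = 0, which increases with s. *)
Variables (c s a : R) (S D : 'M[C]_d) (h : 'cV[C]_d).
Hypotheses (a1 : 1 <= a) (sE : s = 7 / (1000 * a)) (c0 : 0 < c).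
Hypotheses (cs : c ^+ 2 + s ^+ 2 = 1) (SU : S \is unitarymx).
Hypotheses (DH : D^t* = D) (DD : D *m D = D).
Let B := reflector D.
Let BU : B \is unitarymx. Proof. exact: reflector_unitary. Qed.
Let SBU : S *m B \is unitarymx.
Proof. exact: (mul_unitarymx SU BU). Qed.

Let a0 : 0 < a. Proof. exact: lt_le_trans a1. Qed.
Let s0 : 0 < s. Proof. by rewrite sE divr_gt0 // mulr_gt0. Qed.
Let saE : s * a = 7 / 1000. Proof. by rewrite sE; field; rewrite gt_eqF. Qed.
Let s_le : s <= 7 / 1000. Proof. by move: saE s0 a1 => *; nra. Qed.
Let c_ge : 100 / 101 <= c. Proof. exact: cos_ge cs s_le. Qed.
Let tan_le : s / c <= s * (101 / 100).
Proof.
rewrite ler_pdivrMr // -mulrA ler_peMr ?(ltW s0) //.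
exact: le_101_mul c_ge.
Qed.

(** Case f(x) = 1, where the branch |0> is the error. By linearity the start h is g minus g - h: the
    first part leaves cos (T theta) g plus the accumulated drift, the second keeps its norm of at
    most 1/10. *)
Lemma detect_reject T (g : 'cV[C]_d)
    (p := usubmx (iter T (mulmx (rabi c s (S *m B))) (col_mx h 0))) :
    (forall r, (r < T)%N -> 0 <= (cossin c s r).2) ->
    (cossin c s T).1 <= s / c -> 0 <= (cossin c s T).1 ->
    s * \sum_(r < T) (cossin c s r).2 <= 1 ->
    S *m g = g -> rip (g - h) (g - h) <= 1 / 100 -> rip g g <= 101 / 100 ->
    rip (g - D *m g) (g - D *m g) <= (101 / 100) / (400 * 1000 * a ^+ 2) ->
  rip p p <= 1 / 3.
Proof.
move=> sin0 cosle cos0 sum_le Sg gh gg gDg.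
have ng : nrm g <= 101 / 100 by apply: nrm_le_sqr gg le_sqr_101; rewrite divr_ge0.
have ngh : nrm (g - h) <= 1 / 10 by apply: nrm_le_sqr gh le_sqr_10; rewrite divr_ge0.
have u0 : 0 <= (628 * a)^-1 by rewrite invr_ge0 mulr_ge0 // ltW.
have nD : nrm (g - D *m g) <= (628 * a)^-1.
  apply: nrm_le_sqr gDg _ => //.
  have: 0 < a ^+ 2 by rewrite exprn_gt0.
  rewrite exprVn exprMn; move: (a ^+ 2) => y y0.
  rewrite ler_pdivrMr ?mulr_gt0 // [leRHS]mulrC ler_pdivlMr ?mulr_gt0 ?exprn_gt0 //.
  exact: proj_budget.
have nU : nrm (S *m B *m g - g) <= 2 * (628 * a)^-1.
  (* As S g = g, the displacement is S (2 D - 1) g - S g. *)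
  have -> : S *m B *m g - g = (-2)%:C%C *: (S *m (g - D *m g)).
    rewrite -mulmxA /B /reflector mulmxBl mulmxDl mul1mx !mulmxBr mulmxDr Sg.
    rewrite rmorphN rmorph_nat.
    by move: (S *m (D *m g)) => y; apply/colP => i; rewrite !mxE; ring.
  by rewrite rmorphN scaleNr nrmN nrmZ ?ler0n // (nrm_unitary _ SU) ler_wpM2l ?ler0n.
have := rabi_resonant cs SBU nU sin0.
set G := iter T _ _; set z := col_mx _ _ => nG.
have pE : p = (usubmx (G - z) + (cossin c s T).1%:C%C *: g)
            - usubmx (iter T (mulmx (rabi c s (S *m B))) (col_mx (g - h) 0)).
  have -> : col_mx (g - h) 0 = col_mx g 0 + (- 1) *: col_mx h 0 :> 'cV[C]_(d + d).
    by rewrite scaleN1r opp_col_mx add_col_mx subr0.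
  rewrite iter_mulmxD iter_mulmxZ -/G scaleN1r /p.
  move: (iter _ _ _) => H; rewrite !linearB /= col_mxKu subrK.
  by rewrite opprK addNKr.
have nH : nrm (usubmx (iter T (mulmx (rabi c s (S *m B))) (col_mx (g - h) 0))) <= 1 / 10.
  apply: le_trans (nrm_usubmx _) _; rewrite nrm_iter ?rabi_unitary //.
  by rewrite {1}/nrm rip_col_mx rip0r addr0 -/(nrm _).
have nR : (cossin c s T).1 * nrm g <= s * (101 / 100) * (101 / 100).
  by rewrite ler_pM ?nrm_ge0 // (le_trans cosle).
have Xa : \sum_(r < T) (cossin c s r).2 <= a * (1000 / 7).
  by rewrite -(ler_pM2l s0) mulrA saE (le_trans sum_le) ?time_budget.
have nS : 2 * (628 * a)^-1 * \sum_(r < T) (cossin c s r).2 <= 91 / 200.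
  have pos : 0 <= 2 * (628 * a)^-1 by rewrite mulr_ge0.
  apply: le_trans (ler_wpM2l pos Xa) _.
  have -> : 2 * (628 * a)^-1 * (a * (1000 / 7)) = 2 * (1000 / 7) / 628.
    by field; rewrite gt_eqF.
  exact: drift_budget.
rewrite -nrm_sqr; apply: sqr_le_third (nrm_ge0 _) (le_trans _ le_57_575).
have le_p : nrm p <= nrm (G - z) + (cossin c s T).1 * nrm g
    + nrm (usubmx (iter T (mulmx (rabi c s (S *m B))) (col_mx (g - h) 0))).
  rewrite pE; apply: le_trans (nrmD _ _) _; rewrite nrmN lerD2r.
  apply: le_trans (nrmD _ _) _; rewrite nrmZ // lerD2r.
  exact: nrm_usubmx.
exact: reject_budget s_le nR nH nS nG le_p.
Qed.

(** Case f(x) = 0, where the branch |1> is the error. Up to S D w, the start h is a coboundary of S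
    B, so [rabi_reject] applies. *)
Lemma detect_accept T (w : 'cV[C]_d)
    (q := dsubmx (iter T (mulmx (rabi c s (S *m B))) (col_mx h 0))) :
    S *m w = 2 *: h - w -> rip w w <= 101 * a ^+ 2 ->
    rip (D *m w) (D *m w) <= 101 / 400 ->
  rip q q <= 1 / 3.
Proof.
move=> Sw ww Dw.
have nw : nrm w <= 1005 / 100 * a.
  apply: nrm_le_sqr ww _; last by rewrite exprMn le_sqr_1005.
  by apply: mulr_ge0; [apply: divr_ge0 | apply: ltW].
have nDw : nrm (D *m w) <= 503 / 1000.
  by apply: nrm_le_sqr Dw le_sqr_503; rewrite divr_ge0.
(* Here S B w = 2 S D w - S w = 2 S D w - 2 h + w. *)
have hE : h = 2^-1%:C%C *: (w - (S *m B) *m w) + S *m (D *m w).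
  rewrite -mulmxA /B /reflector mulmxBl mulmxDl mul1mx mulmxBr mulmxDr Sw.
  move: (S *m (D *m w)) => y; rewrite fmorphV rmorph_nat.
  by apply/colP => i; rewrite !mxE; field.
have := rabi_reject cs SBU T w (S *m (D *m w)) c0 (ltW s0).
rewrite -hE -/q nrm_unitary // => nq.
rewrite -nrm_sqr; apply: sqr_le_third (nrm_ge0 _) _; apply: le_trans nq _.
apply: le_trans (accept_budget saE); apply: lerD nDw.
by apply: ler_pM; rewrite ?nrm_ge0 ?divr_ge0 ?(ltW s0) ?(ltW c0).
Qed.

End PhaseDetection.

(** * Assembling the algorithm and counting its resources *)

Lemma sizeA_eq0 (R : realType) n m (X : {set bits n})
    (v : bits n -> 'I_n -> 'rV[R[i]]_m) :
  (n == 0)%N || (m == 0)%N -> sizeA X v = 0.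
Proof.
move=> nm; apply: (big_ind (fun z => z = 0)) => // [z y -> ->|x _].
  by rewrite /Order.max ltxx.
apply: big1 => i _; apply: big1 => k _; case/orP: nm => E.
  by have := leq_ltn_trans (leq0n i) (ltn_ord i); rewrite lt0n E.
by have := leq_ltn_trans (leq0n k) (ltn_ord k); rewrite lt0n E.
Qed.

Lemma detect_unitary (R : realType) n m (D : 'M[R[i]]_#|{: Hidx n m}|) (c s : R) :
  D^t* = D -> D *m D = D -> c ^+ 2 + s ^+ 2 = 1 ->
  ctrl (reflector D) *m rotmx _ c s *m ctrl (zphase_mx R n m) \is unitarymx.
Proof.
move=> DH DD cs; apply: mul_unitarymx; last first.
  exact/ctrl_unitary/zphase_unitary.
by apply: mul_unitarymx; [exact/ctrl_unitary/reflector_unitary | exact: rotmx_unitary].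
Qed.

(** The two branches have total weight 1, so it is enough that the wrong one has weight at most 1/3.
    The leading [ctrl (reflector D)] left by [iter_rabi_shift] preserves the weight of each
    branch. *)
Lemma outprob_detect (R : realType) n m (i0 : 'I_n) (D : 'M[R[i]]_#|{: Hidx n m}|)
    (c s : R) (T : nat) (x : bits n) (b : bool)
    (L := ctrl (reflector D) *m rotmx _ c s *m ctrl (zphase_mx R n m))
    (z := iter T (mulmx (rabi c s (refl_mx R m x *m reflector D)))
            (col_mx (hat0 R n m) 0)) :
    D^t* = D -> D *m D = D -> c ^+ 2 + s ^+ 2 = 1 ->
    (if b then rip (usubmx z) (usubmx z) <= 1 / 3
     else rip (dsubmx z) (dsubmx z) <= 1 / 3) ->
  2 / 3 <= outprob T (circuit i0 L T) (t_init m i0) (accept_set m i0) x b.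
Proof.
move=> DH DD cs zb; rewrite outprob_circuit /walk /L.
rewrite -(mulmxA _ (ctrl (zphase_mx R n m))) -ctrlM.
rewrite iter_rabi_shift -/(refl_mx R m x) -/z.
have BU := reflector_unitary DH DD.
rewrite -{1 2 3 4}[z]vsubmxK ctrl_col col_mxKu col_mxKd.
have z1 : rip (usubmx z) (usubmx z) + rip (dsubmx z) (dsubmx z) = 1.
  rewrite -rip_col_mx vsubmxK -nrm_sqr nrm_iter.
    rewrite nrm_sqr rip_col_mx rip0r addr0; apply: (@complexI R).
    by rewrite hat0E rip_qvec normr1 normr0 expr1n expr0n mul0r addr0.
  exact: (rabi_unitary cs (mul_unitarymx (refl_unitary R m x) BU)).
have -> : (2 / 3 : R[i]) = ((2 / 3 : R))%:C%C by rewrite fmorph_div !rmorph_nat.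
rewrite lecR; move: z1 zb.
case: b; [rewrite (rip_unitary (dsubmx z) (dsubmx z) BU) | ];
  by move: (rip (usubmx z) _) (rip (dsubmx z) _) => p q; clear; lra.
Qed.

Theorem theorem16 :
  exists K1 K2 : nat,
  forall (R : realType) (n m : nat) (X : {set bits n}) (f : bits n -> bool)
         (v : bits n -> 'I_n -> 'rV[R[i]]_m),
  let A := sizeA X v in
  let c := cconst R in
  let eps := epsilon X f v in
  let M := Mmat X f v in
  let n1 := #|X1 X f| in
  1 <= A ->
  forall sv : seq R[i], singular_values M sv ->
  (exists2 k : nat, (1 <= k <= \rank M)%N &
     eps <= (sqrtC (n1%:R))^-1
              * (singval sv k / (2 * sqrtC c * A) - singval sv k.+1)
     /\ singval sv k.+1 <= (2 * sqrtC (1000 * c) * A)^-1) ->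
  exists (w T : nat) (U : nat -> 'M[R[i]]_(qdim n w))
         (t0 : 'I_(qdim n w)) (Acc : {set 'I_(qdim n w)}),
    [/\ forall t, (t <= T)%N -> U t \is unitarymx,
        T%:R <= K1%:R * A,
        (qdim n w <= (2 * n * m) ^ K2)%N
      & forall x, x \in X -> outprob T U t0 Acc x (f x) >= 2 / 3].
Proof.
(* The number of queries is at most 3 / s = (3000 / 7) A <= 429 A; the dimension is 4 n (m + 1) <= 4
   (2 n m) <= (2 n m)^3, since 2 n m >= 2. *)
exists 429%N, 3%N => R n m X f v A c eps M n1 A1 sv svM.
move=> [k /andP[k1 kr] [eps_le sg1_le]].
(* A >= 1 rules out empty registers; this supplies the index [i0] on which |hat0> is encoded. *)
have nm : (0 < n)%N && (0 < m)%N.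
  rewrite !lt0n -negb_or; apply/negP => /(sizeA_eq0 X v) E.
  by move: A1; rewrite /A E ler10.
have /andP[n0 m0] := nm; pose i0 : 'I_n := Ordinal n0.
pose a := complex.Re A.
have AE : A = a%:C%C by rewrite RRe_real // ger0_real // (le_trans ler01).
have a1 : 1 <= a by rewrite -lecR -AE.
have a0 : 0 < a by apply: lt_le_trans a1.
pose s := 7 / (1000 * a); pose b := Num.sqrt (1 - s ^+ 2).
have s0 : 0 < s by rewrite divr_gt0 ?mulr_gt0.
have s1 : s < 1 by rewrite ltr_pdivrMr ?mulr_gt0 //; lra.
have b0 : 0 < b by rewrite sqrtr_gt0 subr_gt0 expr_lt1 // ltW.
have bs : b ^+ 2 + s ^+ 2 = 1.
  by rewrite sqr_sqrtr ?subrK // subr_ge0 expr_le1 ?ltW // ltW.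
have [T [T_le sin0 cos_le cos0 sum_le]] := rot_quarter_turn bs b0 s0.
have [D [DH DD Dlow D0 Dtop]] := truncated_projector svM k1.
have sgR j : 0 <= complex.Re (singval sv j) /\
    (complex.Re (singval sv j))%:C%C = singval sv j.
  have sv0 : 0 <= singval sv j.
    case: svM => _ _ /allP pos _; rewrite /singval.
    have [jv|jv] := ltnP j.-1 (size sv); last by rewrite nth_default.
    by apply: pos; rewrite mem_nth.
  have svE : (complex.Re (singval sv j))%:C%C = singval sv j.
    by rewrite RRe_real // ger0_real.
  by split=> //; rewrite -ler0c svE.
have [[sg0 sgE] [sg10 sg1E]] := (sgR k, sgR k.+1).
have n1p : (0 < #|X1 X f|)%N by rewrite (leq_trans k1) // (leq_trans kr) // rank_leq_row.
exists (wdim m), T, (circuit i0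
  (ctrl (reflector D) *m rotmx _ b s *m ctrl (zphase_mx R n m)) T),
  (t_init m i0), (accept_set m i0); split.
- by move=> t _; apply/circuit_unitary/detect_unitary.
- rewrite AE -(rmorph_nat (real_complex R)) -(rmorph_nat (real_complex R) 429).
  rewrite -rmorphM lecR (le_trans T_le) // /s invf_div mulrA ler_pdivrMr //; lra.
- rewrite qdim_wdim; apply: (@leq_trans (4 * (2 * n * m))%N).
    by rewrite -!mulnA leq_mul2l mulnS mul2n -addnn leq_add2r leq_pmulr.
  rewrite expnSr leq_mul2r -[4%N]/(2 ^ 2)%N leq_sqr; apply/orP; right.
  by rewrite -mulnA leq_pmulr // muln_gt0.
move=> x xX; apply: outprob_detect => //; case: ifP => fx.
  have xX1 : x \in X1 X f by rewrite inE xX.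
  apply: (detect_reject a1 erefl b0 bs (refl_unitary R m x) DH DD sin0 cos_le cos0 sum_le
    (g := gvec X v x)).
  - exact: refl_fixed.
  - exact (rip_gvec_hat0_le A1 xX).
  - exact (rip_gvec_le A1 xX).
  - apply (rip_gvec_proj_le A1 AE xX1 Dtop); last exact: sg10.
    by rewrite sg1E.
have xX0 : x \in X0 X f by rewrite inE xX fx.
apply: (detect_accept a1 erefl b0 bs (refl_unitary R m x) DH DD T (w := wvec X v x)).
- exact: refl_flipped.
- exact (rip_wvec_le A1 AE xX).
- apply (rip_wvec_proj_le A1 AE xX0 Dlow D0 n1p sg0 sg10).
  by rewrite sgE sg1E.
Qed.
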